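(* Let $(\mathcal{A},\varphi)$ be a von Neumann algebra with a faithful, normal, tracial state. (i) If $X,Y\in\mathcal{A}$ are self-adjoint, bounded free random variables, then the additive subordination function $\omega_1$ has the expansion $$\omega_1(z)=z-\sum_{n=0}^{\infty}\beta_{2n+1}\bigl(Y,(z-X)^{-1},Y,\ldots,(z-X)^{-1},Y\bigr)$$ in some neighbourhood of infinity. (ii) If $X,Y\in\mathcal{A}$ are positive, bounded free random variables, then the multiplicative subordination function $F$ has the expansion $$F(z)=\sum_{n=0}^{\infty}\beta_{2n+1}(Y,X,Y,\ldots,X,Y)\,z^{n+1}$$ in some neighbourhood of $0$.
   Context: $\mathbb{C}^+$ is the open upper half-plane. ''Free'' means freely independent with respect to $\varphi$. $E_\varphi[\,\cdot\mid X]$ is the $\varphi$-preserving conditional expectation onto the von Neumann subalgebra generated by $X$. Boolean cumulants are the multilinear functionals $\beta_n:\mathcal{A}^n\to\mathbb{C}$ determined recursively by $\varphi(X_1\cdots X_n)=\sum_{\pi\in \mathit{Int}(n)}\prod_{B\in\pi}\beta_{|B|}(X_i;i\in B)$, where $\mathit{Int}(n)$ is the set of partitions of $\{1,\ldots,n\}$ into intervals (arguments within a block in increasing order of index). In $\beta_{2n+1}(Y,W,Y,\ldots,W,Y)$ the arguments alternate, with $n+1$ copies of $Y$ and $n$ copies of $W$. Additive subordination function (Voiculescu, Biane): for free self-adjoint $X,Y$, $\omega_1:\mathbb{C}^+\to\mathbb{C}^+$ is the analytic function with $$E_\varphi\bigl[(z-X-Y)^{-1}\mid X\bigr]=(\omega_1(z)-X)^{-1},\qquad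 z\in\mathbb{C}^+ ;$$ it satisfies $\operatorname{Im}\omega_1(z)\ge\operatorname{Im}z$ and $G_{X+Y}(z)=G_X(\omega_1(z))$, where $G_U(z)=\varphi((z-U)^{-1})$. Multiplicative subordination function (Biane): for free positive $X,Y$, $F:\mathbb{C}^+\to\mathbb{C}^+$ is the analytic function, provided by Biane's theorem, with $\arg F(z)\ge\arg z$ and $$E_\varphi\bigl[zX^{1/2}YX^{1/2}(1-zX^{1/2}YX^{1/2})^{-1}\mid X\bigr]=F(z)X(1-F(z)X)^{-1}.$$ The expansions are identities on the part of the stated neighbourhood that lies in $\mathbb{C}^+$. *)

(* Defs.v *)
From HB Require Import structures.
From mathcomp Require Import all_boot all_order all_algebra.
Set Implicit Arguments.
Unset Strict Implicit.
Unset Printing Implicit Defensive.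
Import Order.TTheory GRing.Theory Num.Theory.
Local Open Scope ring_scope.

Section BooleanCumulants.
Variables (C : comNzRingType) (A : nzRingType) (phi : A -> C).

Definition is_interval n (B : {set 'I_n}) : bool :=
  [forall i in B, forall j in B, forall k : 'I_n,
    (i <= k <= j)%N ==> (k \in B)].

Definition interval_partitions n : {set {set {set 'I_n}}} :=
  [set P : {set {set 'I_n}} |
    partition P [set: 'I_n] && [forall B in P, is_interval B]].

(* [enum B] is increasing, so the arguments keep their order. *)
Definition block_args (s : seq A) (B : {set 'I_(size s)}) : seq A :=
  [seq s`_i | i : 'I_(size s) in B].

Definition one_block n : {set {set 'I_n}} := [set [set: 'I_n]].

(* The moment-cumulant formula solved for the term of the one-block partition;
   [k] is fuel, and [size s] is enough since every other block is shorter. *)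
Fixpoint boolean_cumulant_rec (k : nat) (s : seq A) : C :=
  if k is k'.+1 then
    phi (\prod_(a <- s) a) -
      \sum_(P in interval_partitions (size s) | P != one_block (size s))
        \prod_(B in P) boolean_cumulant_rec k' (block_args B)
  else 0.

Definition boolean_cumulant (s : seq A) : C := boolean_cumulant_rec (size s) s.

Lemma size_block_args (s : seq A) (B : {set 'I_(size s)}) :
  size (block_args B) = #|B|.
Proof. by rewrite /block_args size_map -cardE. Qed.

Lemma block_args_setT (s : seq A) : block_args [set: 'I_(size s)] = s.
Proof.
apply: (@eq_from_nth _ 0); first by rewrite size_block_args cardsT card_ord.
rewrite size_block_args cardsT card_ord => i ilt.
rewrite /block_args (nth_map (Ordinal ilt)); last first.
  by rewrite -cardE cardsT card_ord.
rewrite (eq_enum (B := 'I_(size s))); last by move=> x; rewrite !inE.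
by rewrite nth_enum_ord.
Qed.

Lemma proper_block n (P : {set {set 'I_n}}) (B : {set 'I_n}) :
  P \in interval_partitions n -> P != one_block n -> B \in P ->
  (0 < #|B| < n)%N.
Proof.
rewrite inE => /andP[/and3P[/eqP covP trivP P0] _] Pneq BP.
have B0 : B != set0 by apply: contraNneq P0 => <-.
apply/andP; split; first by rewrite card_gt0.
rewrite -[X in (_ < X)%N]card_ord -cardsT; apply: proper_card.
rewrite properT; apply: contraNneq Pneq => BT; rewrite BT in BP.
apply/eqP/setP => D; rewrite !inE; apply/idP/eqP => [DP|->//].
have [//|DT] := eqVneq D [set: 'I_n].
move/trivIsetP: trivP => /(_ _ _ DP BP DT).
rewrite -setI_eq0 setIT => /eqP D0.
by move: P0; rewrite -D0 DP.
Qed.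

Lemma boolean_cumulant_fuel k s :
  (size s <= k)%N -> s != [::] -> boolean_cumulant_rec k s = boolean_cumulant s.
Proof.
rewrite /boolean_cumulant.
move: {2}(size s) (leqnn (size s)) => m.
elim: m s k => [|m IH] s k; first by rewrite leqn0 size_eq0 => ->.
case: k => [|k]; first by rewrite leqn0 size_eq0 => _ ->.
move=> sm sk s0; case E : (size s) => [|l].
  by move/eqP: E; rewrite size_eq0 (negbTE s0).
rewrite /=; congr (_ - _); apply: eq_bigr => P /andP[PI Pneq].
apply: eq_bigr => B BP.
have /andP[B0 Bn] := proper_block PI Pneq BP.
have Bne : block_args B != [::] by rewrite -size_eq0 size_block_args -lt0n.
have Bl : (size (block_args B) <= l)%N by rewrite size_block_args -ltnS -E.
rewrite (IH _ k) ?(IH _ l) //.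
- by apply: leq_trans Bl _; rewrite -ltnS -E.
- by apply: leq_trans Bl _; rewrite -ltnS -E.
- by apply: leq_trans Bl _; rewrite -ltnS -E.
Qed.

Lemma boolean_moment_cumulant (s : seq A) : s != [::] ->
  phi (\prod_(a <- s) a) =
  \sum_(P in interval_partitions (size s))
    \prod_(B in P) boolean_cumulant (block_args B).
Proof.
move=> s0.
have oneI : one_block (size s) \in interval_partitions (size s).
  rewrite inE; apply/andP; split.
    apply/and3P; split; first by rewrite /cover big_set1.
      by apply/trivIsetP => D D'; rewrite !inE => /eqP-> /eqP->; rewrite eqxx.
    rewrite inE eq_sym -card_gt0 cardsT card_ord.
    by case: (s) s0.
  apply/forallP => B; apply/implyP; rewrite inE => /eqP->.
  by do 2![apply/forallP => ?; apply/implyP => _]; apply/forallP => ?; rewrite inE implybT.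
have sz : (size s).-1.+1 = size s by case: (s) s0.
rewrite (bigD1 _ oneI) /= big_set1 block_args_setT.
rewrite -(boolean_cumulant_fuel (k := (size s).-1.+1)) ?sz //.
rewrite -[X in boolean_cumulant_rec X s]sz [boolean_cumulant_rec _ _]/=.
rewrite [X in _ - X + _](_ : _ = \sum_(P in interval_partitions (size s)
   | P != one_block (size s)) \prod_(B in P) boolean_cumulant (block_args B)).
  by rewrite subrK.
apply: eq_bigr => P /andP[PI Pneq]; apply: eq_bigr => B BP.
have /andP[B0 Bn] := proper_block PI Pneq BP.
apply: boolean_cumulant_fuel; first by rewrite size_block_args -ltnS sz.
by rewrite -size_eq0 size_block_args -lt0n.
Qed.

(* (Y, W, Y, ..., W, Y) with n+1 copies of Y and n copies of W *)
Definition alternating_args (Y W : A) (n : nat) : seq A :=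
  Y :: flatten (nseq n [:: W; Y]).

End BooleanCumulants.

From mathcomp Require Import complex.
From mathcomp Require Import all_classical all_reals all_analysis.
Import numFieldNormedType.Exports.
Local Open Scope classical_set_scope.
Local Open Scope ring_scope.
Local Open Scope complex_scope.

(* A von Neumann algebra of operators on the Hilbert space [(H, dot)], presented
   as a unital algebra [A] with an involution [star] and a faithful
   representation [rep] identifying [A] with a double commutant in B(H).  Taking [A] to
   be a [unitAlgType] only fixes a name [x^-1] for the inverse of the invertible
   elements. *)
Section VonNeumannAlgebras.
Variables (R : realType) (H : completeNormedModType R[i]).
Variable dot : {dot H for Num.conj}.
Variables (A : unitAlgType R[i]) (star : A -> A) (rep : A -> {linear H -> H}).

Definition commutant (S : set A) : set {linear H -> H} :=
  [set T | continuous T /\ forall a, S a -> forall v, T (rep a v) = rep a (T v)].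

Definition bicommutant (S : set A) : set {linear H -> H} :=
  [set T | continuous T /\
    forall U, commutant S U -> forall v, T (U v) = U (T v)].

Record von_neumann_algebra : Prop := {
  vna_hilbert : forall v : H, `|v| ^+ 2 = dot v v;
  vna_bounded : forall a, continuous (rep a);
  vna_linear : forall (k : R[i]) a b v,
    rep (k *: a + b) v = k *: rep a v + rep b v;
  vna_one : forall v, rep 1 v = v;
  vna_mul : forall a b v, rep (a * b) v = rep a (rep b v);
  vna_adjoint : forall a u v, dot (rep a u) v = dot u (rep (star a) v);
  vna_injective : forall a, (forall v, rep a v = 0) -> a = 0;
  vna_bicommutant : forall T, bicommutant setT T ->
    exists a, forall v, T v = rep a v }.

Definition self_adjoint (a : A) : Prop := star a = a.

(* [0 <= w] in [R[i]] means that [w] is a nonnegative real. *)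
Definition positive (a : A) : Prop := forall v, 0 <= dot (rep a v) v.

Definition op_le (a b : A) : Prop := positive (b - a).

Definition op_lub (D : set A) (s : A) : Prop :=
  (forall d, D d -> op_le d s) /\
  (forall t, (forall d, D d -> op_le d t) -> op_le s t).

Definition upward_directed (D : set A) : Prop :=
  D !=set0 /\
  forall a b, D a -> D b -> exists c, [/\ D c, op_le a c & op_le b c].

Record faithful_normal_tracial_state (phi : {scalar A}) : Prop := {
  state_positive : forall a, positive a -> 0 <= phi a;
  state_one : phi 1 = 1;
  state_faithful : forall a, positive a -> phi a = 0 -> a = 0;
  state_normal : forall D s, D `<=` positive -> upward_directed D ->
    op_lub D s -> forall c, (forall d, D d -> phi d <= c) -> phi s <= c;
  state_trace : forall a b, phi (a * b) = phi (b * a) }.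

Record star_subalgebra (B : set A) : Prop := {
  subalg_one : B 1;
  subalg_linear : forall (k : R[i]) a b, B a -> B b -> B (k *: a + b);
  subalg_mul : forall a b, B a -> B b -> B (a * b);
  subalg_star : forall a, B a -> B (star a) }.

Definition von_neumann_subalgebra (B : set A) : Prop :=
  star_subalgebra B /\ forall a, bicommutant B (rep a) -> B a.

Definition star_generated (X : A) : set A :=
  [set a | forall B, star_subalgebra B -> B X -> B a].

Definition vn_generated (X : A) : set A :=
  [set a | forall B, von_neumann_subalgebra B -> B X -> B a].

(* [b] says in which of the two algebras the first factor lies. *)
Definition freely_independent (phi : {scalar A}) (X Y : A) : Prop :=
  forall (b : bool) (s : seq A), s != [::] ->
    (forall i, (i < size s)%N ->
      star_generated (if b (+) odd i then X else Y) s`_i /\ phi s`_i = 0) ->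
    phi (\prod_(a <- s) a) = 0.

Record conditional_expectation (phi : {scalar A}) (B : set A)
    (E : {linear A -> A}) : Prop := {
  ce_range : forall a, B (E a);
  ce_id : forall b, B b -> E b = b;
  ce_positive : forall a, positive a -> positive (E a);
  ce_bimodule : forall b a b', B b -> B b' -> E (b * a * b') = b * E a * b';
  ce_preserves : forall a, phi (E a) = phi a }.

Definition upper_half_plane : set R[i] := [set z | 0 < complex.Im z].

(* Only used on the upper half-plane, where the argument lies in ]0, pi[. *)
Definition argument (z : R[i]) : R := acos (complex.Re z / complex.Re `|z|).

Definition analytic_self_map (f : R[i] -> R[i]) : Prop :=
  forall z, upper_half_plane z ->
    upper_half_plane (f z) /\ derivable (f : R[i]^o -> R[i]^o) z 1.

Definition additive_subordination (E : {linear A -> A}) (X Y : A)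
    (omega1 : R[i] -> R[i]) : Prop :=
  analytic_self_map omega1 /\
  forall z, upper_half_plane z ->
    E (z%:A - X - Y)^-1 = ((omega1 z)%:A - X)^-1.

Definition positive_sqrt (X S : A) : Prop := positive S /\ S * S = X.

(* [S] stands for the square root of [X]. *)
Definition multiplicative_subordination (E : {linear A -> A}) (X S Y : A)
    (F : R[i] -> R[i]) : Prop :=
  [/\ analytic_self_map F,
      forall z, upper_half_plane z -> argument z <= argument (F z) &
      forall z, upper_half_plane z ->
        E ((z *: (S * Y * S)) * (1 - z *: (S * Y * S))^-1) =
        (F z *: X) * (1 - F z *: X)^-1].

End VonNeumannAlgebras.

(* Main.v *)
(* Freeness replaces the conditional expectation by a scalar computation.  Put
   t_0 = Y and t_(n+1) = Y W (t_n - phi(t_n)) with W in the norm closure B of the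
   *-algebra generated by X.  Nested centring gives
   phi(t_n) = beta_(2n+1)(Y, W, Y, ..., W, Y), and t_n - phi(t_n) is a combination
   of centred alternating words ending on the Y side, so phi(b t_n) = phi(b) phi(t_n)
   for b in B.  Summing the recursion with weights z^n, and writing eta for the sum
   of the z^n phi(t_n), gives
     (1 - z Y W) (sum of the z^n t_n) = Y (1 - z eta W),
   hence by traciality
     phi(b (1 - z Y W)^-1 Y) = phi((1 - z eta W)^-1 b) eta.
   With z = 1, W = (z - X)^-1 for (i) and W = X for (ii), this identifies
   phi(b _) of the two sides of the subordination equation.  Both sides lie in B
   (resolvents of X at nonreal points do, by stepping down from infinity with
   Neumann series), so faithfulness of phi on B makes them equal; neither the von
   Neumann algebra generated by X nor the square root of X has to be analysed. *)

Require Import Defs.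
From HB Require Import structures.
From mathcomp Require Import all_boot all_order all_algebra.
Set Implicit Arguments.
Unset Strict Implicit.
Unset Printing Implicit Defensive.
Import Order.TTheory GRing.Theory Num.Theory.
Local Open Scope ring_scope.

(** * Sums over interval partitions, expanded along the first block *)

Section IntervalPartitionSums.
Variables (C : comNzRingType) (n : nat) (g : {set 'I_n} -> C).

Definition segment (i j : nat) : {set 'I_n} := [set k : 'I_n | (i <= k < j)%N].

(** Final segments are allowed in place of all of ['I_n] so that removing the first block leaves an
    object of the same kind. *)
Definition tail_partition (i : nat) (P : {set {set 'I_n}}) : bool :=
  partition P (segment i n) && [forall B in P, is_interval B].

Definition tail_sum (i : nat) : C :=
  \sum_(P | tail_partition i P) \prod_(B in P) g B.

Lemma segment0 i : (n <= i)%N -> segment i n = set0.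
Proof.
move=> ni; apply/setP => k; rewrite !inE; apply/negbTE.
by rewrite negb_and -ltnNge (leq_trans (ltn_ord k)).
Qed.

Lemma segment_interval i j : is_interval (segment i j).
Proof.
apply/'forall_implyP => a; rewrite inE => /andP[ia aj].
apply/'forall_implyP => b; rewrite inE => /andP[ib bj].
apply/'forall_implyP => k /andP[ak kb].
by rewrite inE (leq_trans ia) ?(leq_ltn_trans kb).
Qed.

Lemma tail_sum_end i : (n <= i)%N -> tail_sum i = 1.
Proof.
move=> ni; rewrite /tail_sum (big_pred1 set0) ?big_set0 // => P.
rewrite /tail_partition segment0 // partition_set0 /=.
case: eqP => //= ->; apply/forallP => B; by rewrite inE.
Qed.

(** Every covered index is at least [i], so the block of [i] starts at [i]; being an interval, it is
    the whole segment up to its maximum [j]. *)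
Lemma first_block (i : 'I_n) P : tail_partition i P ->
  exists2 j : 'I_n, (i <= j)%N & segment i j.+1 \in P.
Proof.
move=> /andP[partP /forallP intP].
have iS : i \in segment i n by rewrite inE leqnn ltn_ord.
have covP := cover_partition partP.
have iP : i \in pblock P i by rewrite mem_pblock covP.
have BP : pblock P i \in P by rewrite pblock_mem // covP.
have Bi k : k \in pblock P i -> (i <= k)%N.
  move=> kB; have : k \in cover P by apply/bigcupP; exists (pblock P i).
  by rewrite covP inE => /andP[].
have [j jB jmax] := @arg_maxnP _ i (mem (pblock P i)) val iP.
exists j; first exact: Bi.
rewrite (_ : segment _ _ = pblock P i) //; apply/setP => k; rewrite inE ltnS.
apply/idP/idP => [ikj|kB]; last by rewrite Bi //; exact: jmax.
move/implyP: (intP (pblock P i)) => /(_ BP)/forallP/(_ i)/implyP/(_ iP).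
by move/forallP/(_ j)/implyP/(_ jB)/forallP/(_ k)/implyP/(_ ikj).
Qed.

Lemma first_block_uniq (i j k : 'I_n) P : tail_partition i P ->
  (i <= j)%N -> (i <= k)%N -> segment i j.+1 \in P -> segment i k.+1 \in P -> j = k.
Proof.
move=> /andP[/and3P[_ /trivIsetP tP _] _] ij ik jP kP.
have [E|/(tP _ _ jP kP)] := eqVneq (segment i j.+1) (segment i k.+1).
  apply/val_inj/eqP; rewrite eqn_leq.
  have : j \in segment i k.+1 by rewrite -E inE ij ltnS leqnn.
  have : k \in segment i j.+1 by rewrite E inE ik ltnS leqnn.
  by rewrite !inE => /andP[_ /ltnSE ->] /andP[_ /ltnSE ->].
move/disjoint_setI0/setP/(_ i).
by rewrite !inE leqnn !ltnS ij ik.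
Qed.

Lemma segment_split (i j : 'I_n) : (i <= j)%N ->
  segment i j.+1 :|: segment j.+1 n = segment i n.
Proof.
move=> ij; apply/setP => k; rewrite !inE ltn_ord !andbT ltnS.
case: (leqP k j) => kj; rewrite ?andbT ?andbF ?orbF //=.
by rewrite (leq_trans ij (ltnW kj)).
Qed.

Lemma segment_disjoint (i j : nat) : [disjoint segment i j.+1 & segment j.+1 n].
Proof.
rewrite -setI_eq0; apply/eqP/setP => k; rewrite !inE.
by case: (leqP k j) => kj; rewrite ?andbF //= ltnNge ?kj ?andbF //= -ltnS ltnS leqNgt kj andbF.
Qed.

(** Interval partitions are sorted by the last index [j] of their first block; what remains is an
    arbitrary interval partition of the segment after [j]. *)
Lemma tail_sum_rec (i : 'I_n) :
  tail_sum i = \sum_(j : 'I_n | (i <= j)%N) g (segment i j.+1) * tail_sum j.+1.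
Proof.
(* The default [i] is never reached on a tail partition, by [first_block]; it only makes [f] total
   with values at least [i]. *)
pose f (P : {set {set 'I_n}}) := odflt i [pick j : 'I_n | (i <= j)%N && (segment i j.+1 \in P)].
rewrite /tail_sum (partition_big f (fun j : 'I_n => (i <= j)%N)) /=; last first.
  by move=> P _; rewrite /f; case: pickP => [j /andP[]|].
apply: eq_bigr => j ij.
have fE P : tail_partition i P && (f P == j) =
    tail_partition i P && (segment i j.+1 \in P).
  case tP: (tail_partition i P) => //=; have [k ik kP] := first_block tP.
  rewrite /f; case: pickP => [l /andP[il lP]|/(_ k)]; last by rewrite ik kP.
  apply/eqP/idP => [<- //|jP]; exact: first_block_uniq tP il ij lP jP.
rewrite (eq_bigl _ _ fE) big_distrr /=.
set S := segment i j.+1.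
have iS : i \in S by rewrite inE leqnn ltnS ij.
have S0 : S != set0 by apply/set0Pn; exists i.
(* Since [S] lies outside [Q], adding and removing [S] are mutually inverse, which justifies the
   reindexing below. *)
have SnP Q : tail_partition j.+1 Q -> S \notin Q.
  move=> /andP[pQ _]; apply/negP => SQ.
  have : i \in cover Q by apply/bigcupP; exists S.
  by rewrite (cover_partition pQ) inE ltnNge ij.
rewrite (reindex_onto (fun Q => S |: Q) (fun P => P :\ S)) /=; last first.
  by move=> P /andP[_ SP]; rewrite setD1K.
apply: eq_big => [Q|Q]; last first.
  case/andP=> /andP[_ _] /eqP QE; rewrite big_setU1 //= -QE.
  by rewrite !inE eqxx.
rewrite setU11 andbT; apply/andP/idP => [[/andP[pP iP]] /eqP QE|tQ].
  apply/andP; split.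
    have := partitionD1 pP (setU11 S Q); rewrite QE.
    rewrite (_ : _ :\: S = segment j.+1 n) //.
    rewrite -(segment_split ij) setDUl setDv set0U.
    by apply/setDidPl; rewrite disjoint_sym segment_disjoint.
  apply/'forall_implyP => B BQ; have /forallP/(_ B)/implyP := iP; apply.
  by rewrite inE BQ orbT.
have SQ := SnP _ tQ; split; last by rewrite setU1K.
case/andP: tQ => pQ iQ; apply/andP; split.
  rewrite -(segment_split ij).
  by apply: partitionU1 => //; exact: segment_disjoint.
apply/'forall_implyP => B; rewrite !inE => /orP[/eqP->|BQ].
  exact: segment_interval.
by have /forallP/(_ B)/implyP := iQ; apply.
Qed.

Lemma tail_sum0 :
  tail_sum 0 = \sum_(P in interval_partitions n) \prod_(B in P) g B.
Proof.
apply: eq_bigl => P; rewrite inE /tail_partition (_ : segment 0 n = setT) //.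
by apply/setP => k; rewrite !inE ltn_ord.
Qed.

End IntervalPartitionSums.

Lemma one_block_interval n : (0 < n)%N -> one_block n \in interval_partitions n.
Proof.
move=> n0; rewrite inE; apply/andP; split.
  apply/and3P; split; first by rewrite /cover big_set1.
    by rewrite /trivIset /cover !big_set1.
  rewrite inE eq_sym -card_gt0.
  by rewrite cardsT card_ord.
apply/'forall_implyP => B; rewrite inE => /eqP->.
by do 2![apply/'forall_implyP => ? _]; apply/'forall_implyP => ? _; rewrite inE.
Qed.

(** * Boolean cumulants as moments of nested centrings *)

Section NestedCentering.
Variables (C : comNzRingType) (A : algType C) (phi : {scalar A}).
Hypothesis phi1 : phi 1 = 1.

Let phiZ k a : phi (k *: a) = k * phi a. Proof. exact: linearZ. Qed.

(** With $b^\circ = b - \varphi(b)1$, a nonempty list gives $a_1(a_2(\cdots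
    a_n^\circ\cdots)^\circ)^\circ$; the value [0] on the empty list is a placeholder. *)
Fixpoint nested_centering (s : seq A) : A :=
  if s is a :: s' then
    if s' is [::] then a
    else a * (nested_centering s' - (phi (nested_centering s'))%:A)
  else 0.

Lemma nested_centering_cons a s : s != [::] ->
  nested_centering (a :: s) =
  a * (nested_centering s - (phi (nested_centering s))%:A).
Proof. by case: s. Qed.

(** Induction on the list. With $N$ for the nested centring, $a\,N(s) = N(a,s) + \varphi(N(s))\,a$,
    and the multiples of $a$ add up to the term [j = 0]. Under [phi] this becomes the expansion of a
    moment along its first block. *)
Lemma prod_nested_centering s : s != [::] ->
  \prod_(a <- s) a =
  \sum_(j < size s) phi (\prod_(a <- drop j.+1 s) a) *:
    nested_centering (take j.+1 s).
Proof.
elim: s => // a s IH _; have [->|s0] := eqVneq s [::].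
  rewrite big_cons big_nil big_ord1 /=; by rewrite phi1 scale1r mulr1.
rewrite big_cons big_ord_recl /= take0 drop0.
have E (j : 'I_(size s)) :
    phi (\prod_(b <- drop j.+1 s) b) *: nested_centering (a :: take j.+1 s) =
    a * (phi (\prod_(b <- drop j.+1 s) b) *: nested_centering (take j.+1 s)) -
    (phi (phi (\prod_(b <- drop j.+1 s) b) *: nested_centering (take j.+1 s))) *: a.
  rewrite nested_centering_cons -?size_eq0 ?size_takel //.
  by rewrite mulrBr mulr_algr scalerBr scalerA -scalerAr phiZ.
rewrite (eq_bigr _ (fun j _ => E j)) sumrB -mulr_sumr -scaler_suml.
by rewrite -linear_sum -IH //= addrC subrK.
Qed.

Lemma block_args_segment (s : seq A) (i j : nat) : (i <= j)%N -> (j <= size s)%N ->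
  block_args (segment (size s) i j) = take (j - i) (drop i s).
Proof.
move=> ij js.
have E : map val (enum (segment (size s) i j)) = iota i (j - i).
  have -> : map val (enum (segment (size s) i j)) =
      [seq k <- iota 0 (size s) | i <= k < j]%N.
    rewrite -val_enum_ord filter_map; congr map.
    by rewrite [RHS]/= !enumT; apply: eq_filter => k; rewrite !inE.
  (* Both lists increase strictly, so they agree once they have the same members. *)
  apply: (@irr_sorted_eq _ ltn).
  - exact: ltn_trans.
  - exact: ltnn.
  - by apply: sorted_filter; [exact: ltn_trans|exact: iota_ltn_sorted].
  - exact: iota_ltn_sorted.
  - move=> k; rewrite mem_filter !mem_iota subnKC //= add0n.
    by case: (ltnP k j) => kj; rewrite ?andbF // (leq_trans kj js) andbT.
rewrite /block_args /image_mem.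
have -> : [seq s`_k | k : 'I_(size s) <- enum (segment (size s) i j)] =
    map (nth 0 s) (map val (enum (segment (size s) i j))) by rewrite -map_comp.
by rewrite E map_nth_iota // leq_sub2r.
Qed.

(** The numbers [phi (nested_centering _)] satisfy the moment-cumulant formula, whose solution is
    unique by strong induction on the length. *)
Lemma boolean_cumulantE (s : seq A) : s != [::] ->
  boolean_cumulant phi s = phi (nested_centering s).
Proof.
have [m] := ubnP (size s); elim: m s => // m IH s sm s0.
pose g (B : {set 'I_(size s)}) := phi (nested_centering (block_args B)).
(* Downward induction on [i]: [tail_sum_rec] and [prod_nested_centering] give tail sums and tail
   moments the same recursion. *)
have gs : forall i, (i <= size s)%N ->
    tail_sum g i = phi (\prod_(a <- drop i s) a).
  move=> i; have [k] := ubnP (size s - i); elim: k i => // k IHk i ki.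
  rewrite leq_eqVlt => /orP[/eqP->|ilt].
    by rewrite tail_sum_end // drop_size big_nil phi1.
  rewrite prod_nested_centering; last first.
    by rewrite -size_eq0 size_drop subn_eq0 -ltnNge.
  rewrite (tail_sum_rec g (Ordinal ilt)) /= linear_sum /= size_drop.
  rewrite -(big_geq_mkord i (size s) xpredT (fun j => g (segment _ i j.+1) * tail_sum g j.+1)).
  rewrite -[i in index_iota i]add0n big_addn big_mkord.
  apply: eq_bigr => j _; have jis : (j + i < size s)%N by rewrite addnC -ltn_subRL.
  rewrite phiZ mulrC drop_drop addSn IHk //; last first.
    by rewrite -ltnS (leq_trans _ ki) // ltnS ltn_sub2l // ltnS leq_addl.
  by rewrite /g block_args_segment ?leq_addl ?leqW ?leq_addl // -addSn addnK.
(* Adding the terms with several blocks turns both sides into the full moment; in those terms all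
   blocks are shorter, so the induction hypothesis applies. *)
apply: (@addrI _ (\sum_(P in interval_partitions (size s) | P != one_block (size s))
  \prod_(B in P) boolean_cumulant phi (block_args B))).
have oneI : one_block (size s) \in interval_partitions (size s).
  by apply: one_block_interval; rewrite lt0n size_eq0.
have := gs 0 (leq0n _); rewrite drop0 boolean_moment_cumulant // tail_sum0.
rewrite !(bigD1 _ oneI) /= !big_set1 /g block_args_setT.
rewrite addrC [RHS]addrC => <-; congr (_ + _); apply: eq_bigr => P /andP[PI Pn].
apply: eq_bigr => B BP; have /andP[B0 Bs] := proper_block PI Pn BP.
rewrite IH ?size_block_args -?size_eq0 ?size_block_args -?lt0n //.
exact: leq_trans Bs _.
Qed.
End NestedCentering.

(* Imported only here because the classical [partition] and [cover] would shadow
   those of finset. *)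
From mathcomp Require Import complex ring lra.
From mathcomp Require Import all_classical all_reals all_analysis.
Import Order.TTheory GRing.Theory Num.Theory numFieldNormedType.Exports.
Local Open Scope classical_set_scope.
Local Open Scope ring_scope.
Local Open Scope complex_scope.

(** * Real-valued norms and geometric convergence *)

Section RealNorm.
Variable R : realType.

(** A norm over [R[i]] takes its values in [R[i]]; its real part makes the order and the limits of
    [R] available. *)
Definition rnorm (V : normedZmodType R[i]) (v : V) : R := complex.Re `|v|.

Section ZmodNorm.
Variable V : normedZmodType R[i].
Implicit Types v w : V.

Lemma rnormE v : `|v| = (rnorm v)%:C.
Proof. by rewrite RRe_real // normr_real. Qed.

Lemma rnorm_leE v (c : R) : (rnorm v <= c) = (`|v| <= c%:C).
Proof. by rewrite rnormE lecR. Qed.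

Lemma rnorm_ge0 v : 0 <= rnorm v.
Proof. by rewrite -ler0c -rnormE. Qed.

Lemma rnormD v w : rnorm (v + w) <= rnorm v + rnorm w.
Proof. by rewrite rnorm_leE rmorphD /= -!rnormE ler_normD. Qed.

Lemma rnormN v : rnorm (- v) = rnorm v.
Proof. by rewrite /rnorm normrN. Qed.

Lemma rnorm_distC v w : rnorm (v - w) = rnorm (w - v).
Proof. by rewrite /rnorm distrC. Qed.

Lemma rnorm0 : rnorm (0 : V) = 0.
Proof. by rewrite /rnorm normr0. Qed.

Lemma rnorm_eq0 v : rnorm v = 0 -> v = 0.
Proof. by move=> v0; apply/eqP; rewrite -normr_eq0 rnormE v0. Qed.

End ZmodNorm.

Lemma rnormM (k l : R[i]) : rnorm (k * l) = rnorm k * rnorm l.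
Proof. by apply: complexI; rewrite rmorphM -!rnormE normrM. Qed.

Lemma rnormX (k : R[i]) n : rnorm (k ^+ n) = rnorm k ^+ n.
Proof. by apply: complexI; rewrite rmorphXn -!rnormE normrX. Qed.

Lemma rnormV (k : R[i]) : rnorm k^-1 = (rnorm k)^-1.
Proof. by apply: complexI; rewrite fmorphV -!rnormE normfV. Qed.

Lemma rnormZ (V : normedModType R[i]) (k : R[i]) (v : V) :
  rnorm (k *: v) = rnorm k * rnorm v.
Proof. by apply: complexI; rewrite rmorphM /= -!rnormE normrZ. Qed.

Lemma rnorm_cvgP (V : normedModType R[i]) (s : nat -> V) (l : V) :
  s @ \oo --> l <-> (rnorm (s n - l) @[n --> \oo] --> (0 : R)).
Proof.
split=> [/cvgrPdist_lt sl|sl].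
  apply/cvgrPdist_lt => e e0; have e0' : 0 < e%:C by rewrite ltcR.
  apply: filterS (sl _ e0') => n; rewrite rnormE ltcR sub0r normrN rnorm_distC.
  by rewrite ger0_norm ?rnorm_ge0.
apply/cvgrPdist_lt => e e0; have er : e = (complex.Re e)%:C.
  by rewrite RRe_real // gtr0_real.
rewrite er in e0 *; rewrite ltcR in e0.
move/cvgrPdist_lt: sl => /(_ _ e0); apply: filterS => n.
by rewrite rnormE ltcR sub0r normrN rnorm_distC ger0_norm ?rnorm_ge0.
Qed.

Lemma geometric_increments_le (V : normedZmodType R[i]) (s : nat -> V) (c q : R) :
  0 <= c -> 0 <= q < 1 -> (forall n, rnorm (s n.+1 - s n) <= c * q ^+ n) ->
  forall m k, rnorm (s (m + k)%N - s m) <= c / (1 - q) * q ^+ m.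
Proof.
move=> c0 /andP[q0 q1] sq m k.
have q1' : 0 < 1 - q by rewrite subr_gt0.
(* The factor [1 - q ^+ k] of a finite geometric sum is what lets the induction on [k] close. *)
suff : rnorm (s (m + k)%N - s m) <= c / (1 - q) * q ^+ m * (1 - q ^+ k).
  move=> /le_trans; apply; rewrite ler_piMr ?mulr_ge0 ?invr_ge0 ?exprn_ge0 ?(ltW q1') //.
  by rewrite gerBl exprn_ge0.
elim: k => [|k IH]; first by rewrite addn0 !subrr rnorm0 mulr0.
rewrite addnS -(subrKA (s (m + k)%N)) (le_trans (rnormD _ _)) //.
apply: (le_trans (lerD (sq _) IH)).
rewrite exprD exprSr le_eqVlt; apply/orP; left; apply/eqP; field.
by rewrite gt_eqF.
Qed.

Lemma geometric_increments_cauchy (V : normedModType R[i]) (s : nat -> V) (c q : R) :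
  0 <= c -> 0 <= q < 1 -> (forall n, rnorm (s n.+1 - s n) <= c * q ^+ n) ->
  cauchy (s @ \oo).
Proof.
move=> c0 q01 sq; apply: cauchy_exP => e e0.
have er : e = (complex.Re e)%:C by rewrite RRe_real // gtr0_real.
rewrite er in e0 *; rewrite ltcR in e0.
have : (c / (1 - q) * q ^+ n) @[n --> \oo] --> (0 : R).
  rewrite -(mulr0 (c / (1 - q))); apply: cvgMr; apply: cvg_expr.
  by case/andP: q01 => q0 q1; rewrite ger0_norm.
move/cvgrPdist_lt => /(_ _ e0) [N _ /(_ N (leqnn N)) /= Ne].
exists (s N); exists N => // n /= Nn; rewrite -ball_normE /= rnormE ltcR rnorm_distC.
rewrite -(subnKC Nn); apply: le_lt_trans (geometric_increments_le c0 q01 sq _ _) _.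
by apply: le_lt_trans Ne; rewrite sub0r normrN ler_norm.
Qed.

Lemma rnorm_real (x : R) : rnorm x%:C = `|x|.
Proof. by rewrite /rnorm normc_def /= expr0n addr0 sqrtr_sqr. Qed.

Lemma rnormi : rnorm ('i : R[i]) = 1.
Proof. by rewrite /rnorm normc_def /= expr0n expr1n add0r sqrtr1. Qed.

Lemma rnorm_complex_le (z : R[i]) :
  rnorm z <= `|complex.Re z| + `|complex.Im z|.
Proof.
rewrite {1}[z]complexE (le_trans (rnormD _ _)) //.
by rewrite rnormM rnormi mul1r !rnorm_real.
Qed.

Lemma Re_rnorm (z : R[i]) : `|complex.Re z| <= rnorm z.
Proof. by rewrite -lecR -rnormE normc_ge_Re. Qed.

Lemma Im_rnorm (z : R[i]) : `|complex.Im z| <= rnorm z.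
Proof.
rewrite -normrN -ReiNIm (le_trans (Re_rnorm _)) //.
by rewrite rnormM rnormi mulr1.
Qed.

(** Real and imaginary parts converge absolutely by comparison with a geometric series, and their
    limits are put together. *)
Lemma geometric_series_cvg (u : nat -> R[i]^o) (c q : R) : 0 <= q < 1 ->
  (forall n, rnorm (u n) <= c * q ^+ n) -> cvgn (series u).
Proof.
move=> /andP[q0 q1] uq.
have cv (f : R[i] -> R) : (forall z, `|f z| <= rnorm z) -> cvgn (series (f \o u)).
  move=> fz; apply: normed_cvg.
  apply: (@series_le_cvg _ _ (geometric c q)).
  - by move=> n; exact: normr_ge0.
  - by move=> n; apply: le_trans (uq n); exact: rnorm_ge0.
  - by move=> n; exact: le_trans (fz _) (uq n).
  - by apply: is_cvg_geometric_series; rewrite ger0_norm.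
have cRe := cv _ Re_rnorm; have cIm := cv _ Im_rnorm.
pose re := @complex.Re R; pose im := @complex.Im R.
apply/cvg_ex; exists (limn (series (re \o u)) +i* limn (series (im \o u))).
apply/rnorm_cvgP.
have cv0 (f : R[i] -> R) : cvgn (series (f \o u)) ->
    `|series (f \o u) n - limn (series (f \o u))| @[n --> \oo] --> (0 : R).
  move=> cf; rewrite -[X in _ --> X](@normr0 _ R) -(subrr (limn (series (f \o u)))).
  by apply: cvg_norm; apply: cvgB => //; exact: cvg_cst.
have := cvgD (cv0 re cRe) (cv0 im cIm); rewrite addr0 => cs.
apply: (squeeze_cvgr _ (cvg_cst 0) (cs _)).
apply: nearW => n; rewrite rnorm_ge0 /= (le_trans (rnorm_complex_le _)) //.
have reD : {morph re : x y / x + y} by move=> [? ?] [? ?].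
have imD : {morph im : x y / x + y} by move=> [? ?] [? ?].
rewrite -[complex.Re _]/(re _) -[complex.Im _]/(im _).
rewrite /series /= reD imD (big_morph re reD (erefl : re 0 = 0)).
by rewrite (big_morph im imD (erefl : im 0 = 0)).
Qed.

End RealNorm.

(** * The involution and the operator norm *)

Section OperatorNorm.
Variables (R : realType) (H : completeNormedModType R[i]).
Variable dot : {dot H for Num.conj}.
Variables (A : unitAlgType R[i]) (star : A -> A) (rep : A -> {linear H -> H}).
Hypothesis hA : von_neumann_algebra dot star rep.
Implicit Types (a b c : A) (u v w : H) (k : R[i]).

Lemma dotDl u v w : dot (u + v) w = dot u w + dot v w.
Proof. by rewrite linearDl. Qed.

Lemma dotDr u v w : dot w (u + v) = dot w u + dot w v.
Proof. by rewrite linearDr. Qed.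

Lemma dotZl k u w : dot (k *: u) w = k * dot u w.
Proof. by rewrite linearZl_LR. Qed.

Lemma dotZr k u w : dot w (k *: u) = Num.conj k * dot w u.
Proof. by rewrite linearZr_LR. Qed.

Lemma dotNl u w : dot (- u) w = - dot u w.
Proof. by rewrite -scaleN1r dotZl mulN1r. Qed.

Lemma dotNr u w : dot w (- u) = - dot w u.
Proof. by rewrite -scaleN1r dotZr rmorphN1 mulN1r. Qed.

Lemma dotC u v : dot u v = Num.conj (dot v u).
Proof. by rewrite hermC mul1r. Qed.

Lemma dotE v : dot v v = `|v| ^+ 2.
Proof. by rewrite (vna_hilbert hA). Qed.

Lemma dot_eq0 v : dot v v = 0 -> v = 0.
Proof. by rewrite dotE => /eqP; rewrite expf_eq0 normr_eq0 => /eqP. Qed.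

Lemma cauchy_schwarz u v : `|dot u v| <= `|u| * `|v|.
Proof.
have [->|v0] := eqVneq v 0.
  by rewrite -(scale0r 0) dotZr rmorph0 mul0r normr0 mulr_ge0.
pose p := `|v| ^+ 2; pose q := dot u v.
have p0 : 0 < p by rewrite exprn_gt0 // normr_gt0.
have pc : Num.conj p = p by apply/CrealP; rewrite gtr0_real.
(* This is the usual vector $u - (q/p)v$ multiplied by $p$, which avoids the division. *)
have : 0 <= dot (p *: u - q *: v) (p *: u - q *: v).
  by rewrite dotE exprn_ge0.
rewrite !(dotDl, dotDr, dotNl, dotNr, dotZl, dotZr) pc (dotC v u) !dotE -/q -/p.
rewrite (_ : _ + _ = p * (p * `|u| ^+ 2 - `|q| ^+ 2)); last by rewrite normCK; ring.
rewrite pmulr_rge0 // subr_ge0 mulrC -exprMn.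
by rewrite ler_pXn2r // nnegrE ?normr_ge0 // mulr_ge0.
Qed.

Lemma rnorm_dot u v : rnorm (dot u v) <= rnorm u * rnorm v.
Proof. by rewrite rnorm_leE rmorphM /= -!rnormE cauchy_schwarz. Qed.

Lemma repD a b v : rep (a + b) v = rep a v + rep b v.
Proof. by rewrite -[a]scale1r (vna_linear hA) !scale1r. Qed.

Lemma rep0 v : rep 0 v = 0.
Proof. by apply: (addrI (rep 0 v)); rewrite -repD !addr0. Qed.

Lemma repZ k a v : rep (k *: a) v = k *: rep a v.
Proof. by rewrite -[k *: a]addr0 (vna_linear hA) rep0 addr0. Qed.

Lemma repN a v : rep (- a) v = - rep a v.
Proof. by rewrite -scaleN1r repZ scaleN1r. Qed.

Lemma repB a b v : rep (a - b) v = rep a v - rep b v.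
Proof. by rewrite repD repN. Qed.

Lemma rep_inj a b : (forall v, rep a v = rep b v) -> a = b.
Proof.
move=> ab; apply/subr0_eq/(vna_injective hA) => v.
by rewrite repB ab subrr.
Qed.

(** Adjoints are unique because [rep] is injective; the algebraic laws of [star] are derived from
    this. *)
Lemma star_eq a b : (forall u v, dot (rep a u) v = dot u (rep b v)) -> star a = b.
Proof.
move=> ab; apply: rep_inj => v; apply/subr0_eq/dot_eq0.
by rewrite dotDr dotNr -(vna_adjoint hA) -ab subrr.
Qed.

Lemma starK a : star (star a) = a.
Proof.
by apply: star_eq => u v; rewrite dotC -(vna_adjoint hA) -dotC.
Qed.

Lemma starD a b : star (a + b) = star a + star b.
Proof.
by apply: star_eq => u v; rewrite !repD dotDl dotDr !(vna_adjoint hA).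
Qed.

Lemma starZ k a : star (k *: a) = Num.conj k *: star a.
Proof.
by apply: star_eq => u v; rewrite !repZ dotZl dotZr conjCK (vna_adjoint hA).
Qed.

Lemma starN a : star (- a) = - star a.
Proof. by rewrite -scaleN1r starZ rmorphN1 scaleN1r. Qed.

Lemma starM a b : star (a * b) = star b * star a.
Proof.
by apply: star_eq => u v; rewrite !(vna_mul hA) !(vna_adjoint hA).
Qed.

Lemma positive_star_mul a : positive dot rep (star a * a).
Proof.
by move=> v; rewrite (vna_mul hA) (vna_adjoint hA) starK dotE exprn_ge0.
Qed.

(** The quadratic form of [b = a - star a] vanishes, and over the complex numbers polarisation then
    gives [b = 0]. *)
Lemma positive_self_adjoint a : positive dot rep a -> self_adjoint star a.
Proof.
move=> pa; apply/esym/subr0_eq; set b := a - star a.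
have b0 v : dot (rep b v) v = 0.
  rewrite /b repB dotDl dotNl (vna_adjoint hA (star a)) starK (dotC v).
  by rewrite (_ : Num.conj _ = dot (rep a v) v) ?subrr //; apply/CrealP/ger0_real/pa.
have pol u v : dot (rep b u) v + dot (rep b v) u = 0.
  have := b0 (u + v); rewrite dotDr [rep b (u + v)]linearD !dotDl !b0.
  by rewrite addr0 add0r addrC.
apply: rep_inj => u; rewrite rep0; apply: dot_eq0.
(* Testing against $bu$ and $i\,bu$ gives $\langle b\,bu,u\rangle$ equal to both $-\|bu\|^2$ and
   $\|bu\|^2$. *)
have := pol u ('i%R *: rep b u); have := pol u (rep b u).
rewrite dotZr [rep b (_ *: _)]linearZ /= dotZl conjCi => /eqP; rewrite addr_eq0 => /eqP ->.
rewrite mulrNN -mulrDr -mulr2n => /eqP.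
by rewrite mulf_eq0 mulrn_eq0 (negbTE (neq0Ci _)) => /eqP ->; rewrite oppr0.
Qed.

Definition operator_bound a : set R :=
  [set c | 0 <= c /\ forall v, rnorm (rep a v) <= c * rnorm v].

(** [A] carries no norm of its own, so the operator norm is read off the representation. *)
Definition opnorm a : R := inf (operator_bound a).

Lemma operator_bound_nonempty a : operator_bound a !=set0.
Proof.
have /linear_bounded_continuous/linear_boundedP := @vna_bounded _ _ _ _ _ _ hA a.
move/pinfty_ex_gt0 => [r r0 ar]; exists (complex.Re r).
have rr : r = (complex.Re r)%:C by rewrite RRe_real // gtr0_real.
split=> [|v]; first by rewrite -ler0c -rr ltW.
by rewrite rnorm_leE rmorphM /= -rr -rnormE.
Qed.

Lemma operator_bound_lb a : lbound (operator_bound a) 0.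
Proof. by move=> c []. Qed.

Lemma opnorm_ge0 a : 0 <= opnorm a.
Proof.
by apply: lb_le_inf; [exact: operator_bound_nonempty|exact: operator_bound_lb].
Qed.

Lemma opnorm_le a (c : R) :
  0 <= c -> (forall v, rnorm (rep a v) <= c * rnorm v) -> opnorm a <= c.
Proof.
by move=> c0 ac; apply: ge_inf; [exists 0; exact: operator_bound_lb|split].
Qed.

Lemma opnormP a v : rnorm (rep a v) <= opnorm a * rnorm v.
Proof.
have := rnorm_ge0 v; rewrite le_eqVlt => /orP[/eqP v0|v0].
  have -> : v = 0 by apply: rnorm_eq0.
  by rewrite linear0 !rnorm0 mulr0.
rewrite -ler_pdivrMr //; apply: lb_le_inf; first exact: operator_bound_nonempty.
by move=> c [_ ac]; rewrite ler_pdivrMr.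
Qed.

Lemma opnormD a b : opnorm (a + b) <= opnorm a + opnorm b.
Proof.
apply: opnorm_le => [|v]; first by rewrite addr_ge0 ?opnorm_ge0.
by rewrite repD mulrDl (le_trans (rnormD _ _)) // lerD // opnormP.
Qed.

Lemma opnormZ k a : opnorm (k *: a) <= rnorm k * opnorm a.
Proof.
apply: opnorm_le => [|v]; first by rewrite mulr_ge0 ?opnorm_ge0 ?rnorm_ge0.
by rewrite repZ rnormZ -mulrA ler_wpM2l ?rnorm_ge0 // opnormP.
Qed.

Lemma opnormN a : opnorm (- a) = opnorm a.
Proof.
suff le b : opnorm (- b) <= opnorm b.
  by apply/eqP; rewrite eq_le le -{1}[a]opprK le.
by rewrite -scaleN1r (le_trans (opnormZ _ _)) // rnormN rnorm_real normr1 mul1r.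
Qed.

Lemma opnorm_distC a b : opnorm (a - b) = opnorm (b - a).
Proof. by rewrite -opnormN opprB. Qed.

Lemma opnormM a b : opnorm (a * b) <= opnorm a * opnorm b.
Proof.
apply: opnorm_le => [|v]; first by rewrite mulr_ge0 ?opnorm_ge0.
rewrite (vna_mul hA) (le_trans (opnormP _ _)) // -mulrA.
by rewrite ler_wpM2l ?opnorm_ge0 // opnormP.
Qed.

Lemma opnorm1 : opnorm 1 <= 1.
Proof. by apply: opnorm_le => // v; rewrite (vna_one hA) mul1r. Qed.

Lemma opnorm0 : opnorm 0 = 0.
Proof.
apply/eqP; rewrite eq_le opnorm_ge0 andbT; apply: opnorm_le => // v.
by rewrite rep0 rnorm0 mul0r.
Qed.

Lemma opnormX a n : opnorm (a ^+ n) <= opnorm a ^+ n.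
Proof.
elim: n => [|n IH]; first exact: opnorm1.
by rewrite !exprS (le_trans (opnormM _ _)) // ler_wpM2l ?opnorm_ge0.
Qed.

Lemma opnorm_star a : opnorm (star a) <= opnorm a.
Proof.
apply: opnorm_le => [|v]; first exact: opnorm_ge0.
set w := rep (star a) v.
(* From $\|w\|^2 = \langle v, aw\rangle$ and Cauchy-Schwarz; one factor $\|w\|$ is cancelled
   afterwards. *)
have : rnorm w * rnorm w <= opnorm a * rnorm w * rnorm v.
  have -> : rnorm w * rnorm w = rnorm (dot w w).
    by rewrite dotE rnormX expr2 /rnorm normr_id.
  rewrite {1}/w (vna_adjoint hA) starK (dotC v) /rnorm norm_conjC.
  rewrite -/(rnorm _) (le_trans (rnorm_dot _ _)) //.
  by rewrite ler_wpM2r ?rnorm_ge0 // opnormP.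
have := rnorm_ge0 w; rewrite le_eqVlt => /orP[/eqP <- _|w0].
  by rewrite mulr_ge0 ?opnorm_ge0 ?rnorm_ge0.
by rewrite mulrAC ler_pM2r.
Qed.

End OperatorNorm.

(** * Inverses in the von Neumann algebra *)

Section Invertibility.
Variables (R : realType) (H : completeNormedModType R[i]).
Variable dot : {dot H for Num.conj}.
Variables (A : unitAlgType R[i]) (star : A -> A) (rep : A -> {linear H -> H}).
Hypothesis hA : von_neumann_algebra dot star rep.
Implicit Types (a b c : A) (u v w : H) (k : R[i]).
Local Notation opnorm := (opnorm rep).

(** The double commutant property enters here: a bounded inverse operator of [rep b] commutes with
    everything that commutes with [rep A], hence comes from an element of [A]. *)
Lemma bounded_inverse_unit b (g : H -> H) (m : R) :
  (forall v, rep b v = 0 -> v = 0) -> (forall v, rep b (g v) = v) ->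
  (forall v, rnorm (g v) <= m * rnorm v) -> b \is a GRing.unit.
Proof.
move=> b0 bg gm.
have binj u v : rep b u = rep b v -> u = v.
  by move=> uv; apply/subr0_eq/b0; rewrite linearB uv subrr.
have glin : linear g by move=> k u v; apply: binj; rewrite linearP !bg.
pose T : {linear H -> H} := HB.pack g (GRing.isLinear.Build _ _ _ _ g glin).
have Tc : continuous T.
  apply/linear_bounded_continuous/linear_boundedP.
  near=> r => v; rewrite rnormE (le_trans (y := (m * rnorm v)%:C)) ?lecR ?gm //.
  rewrite rmorphM /= -rnormE ler_wpM2r ?normr_ge0 //.
  by near: r; apply: nbhs_pinfty_ge; by apply/complex_realP; exists m.
have Tb : bicommutant rep setT T.
  split=> // U [_ Ub] v; apply: binj.
  by rewrite -Ub // /T /= !bg.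
have [c Tc'] := vna_bicommutant hA Tb.
have bc : b * c = 1.
  by apply: (rep_inj hA) => v; rewrite (vna_mul hA) -Tc' (vna_one hA) /T /= bg.
apply/unitrP; exists c; split=> //.
apply: (rep_inj hA) => v; apply: binj.
by rewrite -!(vna_mul hA) mulrA bc mul1r mulr1.
Unshelve. all: by end_near. Qed.

(** The operator of [1 - a] is bounded below by [1 - opnorm a], and it is onto by a Neumann series
    summed vector by vector in the complete space [H]. *)
Lemma neumann_unit a : opnorm a < 1 -> 1 - a \is a GRing.unit.
Proof.
move=> a1; set q := opnorm a; have q0 : 0 <= q := opnorm_ge0 hA a.
have q1 : 0 < 1 - q by rewrite subr_gt0.
have low v : (1 - q) * rnorm v <= rnorm (rep (1 - a) v).
  rewrite (repB hA) (vna_one hA) mulrBl mul1r lerBlDr -{1}(subrK (rep a v) v).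
  by rewrite (le_trans (rnormD _ _)) // lerD2l (opnormP hA).
have sol v : exists u, rep (1 - a) u = v.
  (* Iterating $u \mapsto v + au$ from $0$ produces the partial sums $\sum_{i<n} a^i v$. *)
  pose s := fix s n : H := if n is n'.+1 then v + rep a (s n') else 0.
  have sq n : rnorm (s n.+1 - s n) <= rnorm v * q ^+ n.
    elim: n => [|n IH]; first by rewrite /= linear0 addr0 subr0 mulr1.
    rewrite (_ : s n.+2 - s n.+1 = rep a (s n.+1 - s n)); last first.
      by rewrite linearB /= opprD addrACA subrr add0r.
    rewrite (le_trans (opnormP hA _ _)) // exprS mulrCA.
    by rewrite ler_wpM2l.
  have q01 : 0 <= q < 1 by rewrite q0.
  have /cauchy_cvg/cvg_ex[u su] := geometric_increments_cauchy (rnorm_ge0 v) q01 sq.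
  have c1 : rep (1 - a) (s n) @[n --> \oo] --> rep (1 - a) u.
    exact: (continuous_cvg _ (@vna_bounded _ _ _ _ _ _ hA (1 - a) u) su).
  have c2 : rep (1 - a) (s n) @[n --> \oo] --> v.
    apply/rnorm_cvgP.
    have qn : rnorm v * q ^+ n @[n --> \oo] --> (0 : R).
      by rewrite -(mulr0 (rnorm v)); apply: cvgMr; apply: cvg_expr; rewrite ger0_norm.
    apply: (squeeze_cvgr _ (cvg_cst 0) qn); apply: nearW => n.
    rewrite rnorm_ge0 /= (le_trans _ (sq n)) // rnorm_distC (repB hA) (vna_one hA).
    by rewrite opprB addrA.
  by exists u; exact: cvg_unique c1 c2.
pose g v := projT1 (cid (sol v)).
have bg v : rep (1 - a) (g v) = v by rewrite /g; case: cid.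
apply: (@bounded_inverse_unit _ g (1 - q)^-1) => // v.
  move=> v0; apply: rnorm_eq0; apply/eqP; rewrite eq_le rnorm_ge0 andbT.
  by have := low v; rewrite v0 rnorm0 pmulr_rle0.
by rewrite mulrC ler_pdivlMr // mulrC (le_trans (low _)) // bg.
Qed.

(** * Norm-closed star-subalgebras *)

Definition norm_closed (S : set A) : Prop :=
  forall a, (forall e : R, 0 < e -> exists2 b, S b & opnorm (a - b) < e) -> S a.

Definition norm_closure (S : set A) : set A :=
  [set a | forall e : R, 0 < e -> exists2 b, S b & opnorm (a - b) < e].

Lemma sub_norm_closure S : S `<=` norm_closure S.
Proof. by move=> a Sa e e0; exists a; rewrite // subrr (opnorm0 hA). Qed.

Lemma norm_closure_closed S : norm_closed (norm_closure S).
Proof.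
move=> a Sa e e0; have e20 : 0 < e / 2 by rewrite divr_gt0.
have [b /(_ _ e20)[c Sc bc] ab] := Sa _ e20; exists c => //.
rewrite -(subrKA b) (le_lt_trans (opnormD hA _ _)) //.
by rewrite [e]splitr ltrD.
Qed.

Section Subalgebras.
Variable S : set A.
Hypothesis hS : star_subalgebra star S.

Lemma subalgZ k a : S a -> S (k *: a).
Proof.
move=> Sa; have S0 : S 0.
  by rewrite -(addNr 1) -scaleN1r; apply: (subalg_linear hS) => //; exact: (subalg_one hS).
by rewrite -[_ *: _]addr0; exact: (subalg_linear hS).
Qed.

Lemma subalg0 : S 0.
Proof. by rewrite -(scale0r 1); apply/subalgZ/(subalg_one hS). Qed.

Lemma subalgD a b : S a -> S b -> S (a + b).
Proof. by move=> Sa Sb; rewrite -[a]scale1r; exact: (subalg_linear hS). Qed.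

Lemma subalgB a b : S a -> S b -> S (a - b).
Proof.
by move=> Sa Sb; apply: subalgD => //; rewrite -scaleN1r; exact: subalgZ.
Qed.

Lemma subalg_scalar k : S k%:A.
Proof. exact/subalgZ/(subalg_one hS). Qed.

Lemma subalg_sum n (f : nat -> A) : (forall i, S (f i)) -> S (\sum_(i < n) f i).
Proof. by move=> Sf; elim/big_ind: _ => [|a b|i _] //; [exact: subalg0|exact: subalgD]. Qed.

Lemma subalgX a n : S a -> S (a ^+ n).
Proof.
move=> Sa; elim: n => [|n IH]; first exact: (subalg_one hS).
by rewrite exprS; exact: (subalg_mul hS).
Qed.

Lemma norm_closure_subalgebra : star_subalgebra star (norm_closure S).
Proof.
split.
- by apply/sub_norm_closure/(subalg_one hS).
- move=> k a b Sa Sb e e0; have e20 : 0 < e / 2 by rewrite divr_gt0.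
  have k0 : 0 < 1 + rnorm k by rewrite ltr_pwDl ?rnorm_ge0.
  have [b' Sb' bb] := Sb _ e20.
  have [a' Sa' aa] := Sa _ (divr_gt0 e20 k0).
  exists (k *: a' + b'); first exact: (subalg_linear hS).
  rewrite opprD addrACA -scalerBr (le_lt_trans (opnormD hA _ _)) //.
  rewrite [e]splitr ltrD // (le_lt_trans (opnormZ hA _ _)) //.
  rewrite ltr_pdivlMr // in aa; apply: le_lt_trans aa; rewrite mulrC.
  by rewrite ler_wpM2l ?(opnorm_ge0 hA) // lerDr.
- move=> a b Sa Sb e e0.
  have nb := opnorm_ge0 hA b; have na := opnorm_ge0 hA a.
  have k0 : 0 < 1 + opnorm a by rewrite ltr_pwDl.
  have l0 : 0 < 2 + opnorm b by rewrite ltr_pwDl.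
  have d0 : 0 < e / 2 / (2 + opnorm b) by rewrite !divr_gt0.
  (* The cap at [1] keeps [opnorm b'] below [2 + opnorm b], the factor by which the tolerance [d0]
     for [a'] was divided. *)
  have m0 : 0 < Num.min 1 (e / 2 / (1 + opnorm a)) by rewrite lt_min ltr01 !divr_gt0.
  have [b' Sb'] := Sb _ m0; rewrite lt_min ltr_pdivlMr // => /andP[b1 bb].
  have [a' Sa'] := Sa _ d0; rewrite ltr_pdivlMr // => aa.
  exists (a' * b'); first exact: (subalg_mul hS).
  rewrite (_ : a * b - _ = a * (b - b') + (a - a') * b'); last first.
    by rewrite mulrBr mulrBl subrKA.
  have b'l : opnorm b' <= 2 + opnorm b.
    have := opnormD hA (b' - b) b; rewrite subrK (opnorm_distC hA).
    by move: b1; lra.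
  rewrite (le_lt_trans (opnormD hA _ _)) // [e]splitr ltrD //.
    rewrite (le_lt_trans (opnormM hA _ _)) //; apply: le_lt_trans bb.
    by rewrite mulrC ler_wpM2l ?(opnorm_ge0 hA) // lerDr.
  rewrite (le_lt_trans (opnormM hA _ _)) //; apply: le_lt_trans aa.
  by rewrite ler_wpM2l ?(opnorm_ge0 hA).
- move=> a Sa e e0; have [b Sb ab] := Sa _ e0.
  exists (star b); first exact: (subalg_star hS).
  by rewrite -(starN hA) -(starD hA) (le_lt_trans (opnorm_star hA _)).
Qed.

Hypothesis clS : norm_closed S.

(** The finite sums $\sum_{i<n} a^i$ lie in [S] and differ from the inverse by $(1-a)^{-1}a^n$. *)
Lemma neumann_mem a : S a -> opnorm a < 1 -> S (1 - a)^-1.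
Proof.
move=> Sa a1; have u := neumann_unit a1; apply: clS => e e0.
have q1 : `|opnorm a| < 1 by rewrite ger0_norm ?(opnorm_ge0 hA).
have : opnorm (1 - a)^-1 * opnorm a ^+ n @[n --> \oo] --> (0 : R).
  by rewrite -(mulr0 (opnorm (1 - a)^-1)); apply: cvgMr; exact: cvg_expr.
move=> /cvgrPdist_lt => /(_ _ e0) [n _ /(_ n (leqnn n)) /= ne].
exists (\sum_(i < n) a ^+ i); first by apply: subalg_sum => i; exact: subalgX.
rewrite (_ : _ - _ = (1 - a)^-1 * a ^+ n); last first.
  apply: (mulrI u); rewrite mulrBr mulrA divrr // mul1r.
  by rewrite -[X in X * \sum_(i < n) _]opprB mulNr -subrX1 opprK addrC subrK.
rewrite (le_lt_trans (opnormM hA _ _)) //; apply: le_lt_trans ne.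
rewrite sub0r normrN (le_trans _ (ler_norm _)) //.
by rewrite ler_wpM2l ?(opnorm_ge0 hA) ?(opnormX hA).
Qed.

(** * Resolvents of a self-adjoint element *)

Variable X : A.
Hypotheses (SX : S X) (hX : self_adjoint star X).

(** As $\langle Xv,v\rangle$ is real, the imaginary part of $\langle (k-X)v,v\rangle$ is
    $\operatorname{Im}(k)\,\|v\|^2$; Cauchy-Schwarz does the rest. *)
Lemma resolvent_bounded_below k v :
  `|complex.Im k| * rnorm v <= rnorm (rep (k%:A - X) v).
Proof.
have := rnorm_ge0 v; rewrite le_eqVlt => /orP[/eqP <-|v0].
  by rewrite mulr0 rnorm_ge0.
rewrite -(ler_pM2r v0) (le_trans _ (rnorm_dot hA _ _)) //.
apply: le_trans (Im_rnorm _).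
rewrite (repB hA) (repZ hA) (vna_one hA) (dotDl dot) (dotNl dot) (dotZl dot) (dotE hA).
have -> : complex.Im (k * `|v| ^+ 2 - dot (rep X v) v) = complex.Im k * (rnorm v * rnorm v).
  have : complex.Im (dot (rep X v) v) = 0.
    have : dot (rep X v) v \is Num.real.
      by apply/CrealP; rewrite -(dotC dot) (vna_adjoint hA) hX.
    by move/RRe_real => <-.
  rewrite rnormE -rmorphXn /=; case: (dot _ _) => x y /= ->.
  by case: (k) => x' y' /=; ring.
by rewrite normrM [`|_ * rnorm v|]ger0_norm ?mulr_ge0 ?rnorm_ge0 // mulrA.
Qed.

Lemma resolvent_norm k : complex.Im k != 0 -> k%:A - X \is a GRing.unit ->
  opnorm (k%:A - X)^-1 <= `|complex.Im k|^-1.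
Proof.
move=> k0 u; apply: (opnorm_le (rep := rep)) => [|v]; first by rewrite invr_ge0.
rewrite mulrC ler_pdivlMr ?normr_gt0 // mulrC.
rewrite (le_trans (resolvent_bounded_below _ _)) //.
by rewrite -(vna_mul hA) divrr // (vna_one hA).
Qed.

Lemma large_resolvent_mem k : opnorm X < rnorm k ->
  k%:A - X \is a GRing.unit /\ S (k%:A - X)^-1.
Proof.
move=> Xk; have k0 : k != 0.
  apply: contraTneq Xk => ->; rewrite -leNgt rnorm0; exact: (opnorm_ge0 hA).
have kX : opnorm (k^-1 *: X) < 1.
  rewrite (le_lt_trans (opnormZ hA _ _)) // rnormV mulrC ltr_pdivrMr ?mul1r //.
  by apply: le_lt_trans Xk; exact: (opnorm_ge0 hA).
have -> : k%:A - X = k *: (1 - k^-1 *: X).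
  by rewrite scalerBr scalerA divff // scale1r.
have uk : k \is a GRing.unit by rewrite unitfE.
have u := neumann_unit kX.
split; first by rewrite scaler_unit.
rewrite invrZ //; apply: subalgZ.
by apply: neumann_mem => //; exact: subalgZ.
Qed.

(** Doubling the imaginary part finitely often leads to a point of modulus above [opnorm X], where
    the Neumann series converges; the induction on [n] comes back down one halving at a time. *)
Lemma resolvent_mem k : complex.Im k != 0 ->
  k%:A - X \is a GRing.unit /\ S (k%:A - X)^-1.
Proof.
move=> k0; have k0' : 0 < `|complex.Im k| by rewrite normr_gt0.
have [n] : exists n, opnorm X < `|complex.Im k| * 2 ^+ n.
  pose n := Num.bound (opnorm X / `|complex.Im k|); exists n.
  rewrite mulrC -ltr_pdivrMr //.
  have := archi_boundP (divr_ge0 (opnorm_ge0 hA X) (ltW k0')).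
  move=> /lt_trans; apply; rewrite -natrX ltr_nat -/n.
  exact: ltn_expl.
elim: n k k0 {k0'} => [|n IH] k k0 kn.
  apply: large_resolvent_mem; apply: lt_le_trans kn _.
  by rewrite mulr1 Im_rnorm.
(* Adding [d] doubles the imaginary part, so the resolvent [W] at [k + d] has norm at most
   $1/(2|\operatorname{Im} k|)$ and [d *: W] has norm at most $1/2$. *)
pose d : R[i] := 'i * (complex.Im k)%:C.
have Imd : complex.Im (k + d) = complex.Im k * 2.
  by rewrite /d; case: (k) => x y /=; ring.
have Ikd : complex.Im (k + d) != 0 by rewrite Imd mulf_neq0 // pnatr_eq0.
have [||u Su] := IH (k + d) => //.
  by rewrite Imd normrM [`|2|]ger0_norm // -mulrA -exprS.
set W := ((k + d)%:A - X)^-1 in Su.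
have dW : opnorm (d *: W) < 1.
  rewrite (le_lt_trans (opnormZ hA _ _)) // rnormM rnormi mul1r rnorm_real.
  rewrite (le_lt_trans (ler_wpM2l _ (resolvent_norm Ikd u))) //.
  rewrite Imd normrM [`|2|]ger0_norm // invfM mulrA divff ?normr_eq0 // mul1r.
  by rewrite invf_lt1 ?ltr1n.
have -> : k%:A - X = ((k + d)%:A - X) * (1 - d *: W).
  rewrite mulrBr mulr1 -scalerAr /W divrr // -addrA.
  by rewrite -[in RHS](addrC (- _)) addrA scalerDl addrK.
have ud := neumann_unit dW.
split; first by rewrite unitrMr.
rewrite invrM //; apply: (subalg_mul hS) => //.
by apply: neumann_mem => //; exact: subalgZ.
Qed.

End Subalgebras.

End Invertibility.

(** * Boundedness and faithfulness of the trace *)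

Section State.
Variables (R : realType) (H : completeNormedModType R[i]).
Variable dot : {dot H for Num.conj}.
Variables (A : unitAlgType R[i]) (star : A -> A) (rep : A -> {linear H -> H}).
Variable phi : {scalar A}.
Hypothesis hA : von_neumann_algebra dot star rep.
Hypothesis hphi : faithful_normal_tracial_state dot rep phi.
Implicit Types (a b c : A) (k : R[i]).
Local Notation opnorm := (opnorm rep).

Lemma stateD a b : phi (a + b) = phi a + phi b.
Proof. exact: linearD. Qed.

Lemma stateZ k a : phi (k *: a) = k * phi a.
Proof. exact: linearZ. Qed.

Lemma stateB a b : phi (a - b) = phi a - phi b.
Proof. exact: linearB. Qed.

Lemma state_scalar k : phi k%:A = k.
Proof. by rewrite stateZ (state_one hphi) mulr1. Qed.

(** Positivity of [phi] on $\|a\|1 - a$. The inequality lives in [R[i]], so it also says that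
    [phi a] is real. *)
Lemma self_adjoint_state_le a :
  self_adjoint star a -> phi a <= (opnorm a)%:C.
Proof.
move=> sa; rewrite -subr_ge0 -{1}[(opnorm a)%:C]state_scalar -stateB.
apply: (state_positive hphi) => v.
rewrite (repB hA) (repZ hA) (vna_one hA) (dotDl dot) (dotNl dot) (dotZl dot) subr_ge0.
have real : dot (rep a v) v \is Num.real.
  by apply/CrealP; rewrite -(dotC dot) (vna_adjoint hA) sa.
rewrite (le_trans (real_ler_norm real)) // (le_trans (cauchy_schwarz hA _ _)) //.
rewrite (dotE hA) expr2 mulrA ler_wpM2r ?normr_ge0 // !rnormE -rmorphM lecR.
exact: (opnormP hA).
Qed.

Lemma state_bounded a : rnorm (phi a) <= opnorm a.
Proof.
have [->|pa0] := eqVneq (phi a) 0; first by rewrite rnorm0 (opnorm_ge0 hA).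
(* Rotating by the phase [u] makes [phi b] equal to $|\varphi(a)|$, so that the bound for
   self-adjoint elements can be applied to [h]. *)
pose u := Num.conj (phi a) / `|phi a|.
have u1 : rnorm u = 1.
  apply: complexI; rewrite -rnormE normrM norm_conjC normfV normr_id divff //.
  by rewrite normr_eq0.
pose b := u *: a.
have pb : phi b = `|phi a|.
  rewrite stateZ /u mulrAC [_ * phi a]mulrC -normCK expr2 mulfK //.
  by rewrite normr_eq0.
have nb : opnorm b <= opnorm a.
  by rewrite (le_trans (opnormZ hA _ _)) // u1 mul1r.
pose h := b + star b; pose g := ('i : R[i]) *: (b - star b).
have sh : self_adjoint star h.
  by rewrite /self_adjoint /h (starD hA) (starK hA) addrC.
have sg : self_adjoint star g.
  rewrite /self_adjoint /g (starZ hA) (starD hA) (starN hA) (starK hA).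
  by rewrite conjCi scaleNr -scalerN opprB addrC.
(* Reality of [phi h] and [phi g] forces [phi (star b) = phi b], whence $\varphi(h) =
   2|\varphi(a)|$. *)
have real c : self_adjoint star c -> complex.Im (phi c) = 0.
  by move/self_adjoint_state_le; rewrite lecE /= eq_sym => /andP[/eqP].
have pg := real _ sg; have ph := real _ sh.
have hle := self_adjoint_state_le sh.
have nh : opnorm h <= 2 * opnorm a.
  rewrite (le_trans (opnormD hA _ _)) // mulr_natl mulr2n lerD //.
  by rewrite (le_trans (opnorm_star hA _)).
move: pg ph hle; rewrite /g /h stateZ stateB stateD pb rnormE.
case: (phi (star b)) => x y /=; rewrite lecE /= => pg ph /andP[_ hle].
move: nh hle pg ph; rewrite -/h; lra.
Qed.

Lemma state_star_mul_eq0 a : phi (star a * a) = 0 -> a = 0.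
Proof.
move=> a0; have := state_faithful hphi (positive_star_mul hA a) a0.
move=> aa; apply: (rep_inj hA) => v; rewrite (rep0 hA); apply: (dot_eq0 hA).
by rewrite (vna_adjoint hA) -(vna_mul hA) aa (rep0 hA) -(scale0r 0) (dotZr dot) rmorph0 mul0r.
Qed.

Lemma norm_closure_state (S : set A) a : (forall b, S b -> phi (b * a) = 0) ->
  forall b, norm_closure rep S b -> phi (b * a) = 0.
Proof.
move=> Sa b Sb; apply/rnorm_eq0/eqP; rewrite eq_le rnorm_ge0 andbT.
apply/ler_addgt0Pr => e e0; rewrite add0r.
have a0 : 0 < 1 + opnorm a by rewrite ltr_pwDl ?(opnorm_ge0 hA).
have [c Sc] := Sb _ (divr_gt0 e0 a0); rewrite ltr_pdivlMr // => bc.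
rewrite -[b](subrK c) mulrDl stateD (Sa c) // addr0 (le_trans (state_bounded _)) //.
rewrite (le_trans (opnormM hA _ _)) // (le_trans _ (ltW bc)) //.
by rewrite ler_wpM2l ?(opnorm_ge0 hA) // lerDr.
Qed.

Lemma star_generated_subalgebra (X : A) :
  star_subalgebra star (star_generated star X).
Proof.
split=> [B hB _|k a b aX bX B hB BX|a b aX bX B hB BX|a aX B hB BX].
- exact: subalg_one hB.
- by apply: (subalg_linear hB); [exact: aX|exact: bX].
- by apply: (subalg_mul hB); [exact: aX|exact: bX].
- by apply: (subalg_star hB); exact: aX.
Qed.

(** * Centred alternating words in free variables *)

Section Freeness.
Variables X Y : A.
Hypothesis free : freely_independent star phi X Y.
Local Notation algX := (star_generated star X).
Local Notation algY := (star_generated star Y).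
Let hX := star_generated_subalgebra X.
Let hY := star_generated_subalgebra Y.

(** The index is [true] when the first letter comes from [algX]. The only base case is a letter of
    [algY], so every word ends on the [Y] side. *)
Inductive alternating_word : bool -> A -> Prop :=
| word_last y : algY y -> phi y = 0 -> alternating_word false y
| word_left x w : algX x -> phi x = 0 -> alternating_word false w ->
    alternating_word true (x * w)
| word_right y w : algY y -> phi y = 0 -> alternating_word true w ->
    alternating_word false (y * w).

Inductive word_span : A -> Prop :=
| span0 : word_span 0
| span_cons k (b : bool) w v : alternating_word b w -> word_span v ->
    word_span (k *: w + v).

Lemma alternating_word_list (b : bool) w : alternating_word b w ->
  exists s, [/\ s != [::], w = \prod_(a <- s) a &
    forall i, (i < size s)%N ->
      star_generated star (if b (+) odd i then X else Y) s`_i /\ phi s`_i = 0].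
Proof.
elim=> {b w} [y Yy y0|x w Xx x0 _ [s [s0 -> hs]]|y w Yy y0 _ [s [s0 -> hs]]].
- exists [:: y]; rewrite big_seq1; split=> // i.
  by case: i.
- exists (x :: s); rewrite big_cons; split=> // -[|i] //= /hs /=; by case: odd.
- exists (y :: s); rewrite big_cons; split=> // -[|i] //= /hs /=; by case: odd.
Qed.

Lemma alternating_word_state (b : bool) w : alternating_word b w -> phi w = 0.
Proof.
by move/alternating_word_list => [s [s0 -> hs]]; exact: (free s0 hs).
Qed.

Lemma word_span_state v : word_span v -> phi v = 0.
Proof.
elim=> [|k b w v' /alternating_word_state w0 _ v0]; first exact: linear0.
by rewrite stateD stateZ w0 v0 mulr0 addr0.
Qed.

Lemma word_spanD v w : word_span v -> word_span w -> word_span (v + w).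
Proof.
elim=> [|k b u v' bu _ IH] sw; first by rewrite add0r.
by rewrite -addrA; apply: span_cons bu (IH sw).
Qed.

Lemma word_spanZ k v : word_span v -> word_span (k *: v).
Proof.
elim=> [|l b u v' bu _ IH]; first by rewrite scaler0; exact: span0.
by rewrite scalerDr scalerA; apply: span_cons bu IH.
Qed.

Lemma word_span1 (b : bool) w : alternating_word b w -> word_span w.
Proof. by move=> bw; rewrite -[w]addr0 -[w]scale1r; exact: span_cons bw span0. Qed.

Lemma centered_split a w : a * w = (a - (phi a)%:A) * w + phi a *: w.
Proof. by rewrite mulrBl mulr_algl subrK. Qed.

Lemma state_centered a : phi (a - (phi a)%:A) = 0.
Proof. by rewrite stateB state_scalar subrr. Qed.

(** The first [X]-letter of the product is split into its centred part and a scalar. Since words end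
    in a [Y]-letter, the scalar part still multiplies a word, so no constant term arises. *)
Lemma word_span_mulX x v : algX x -> word_span v -> word_span (x * v).
Proof.
move=> Xx; elim=> [|k b w v' bw _ IH]; first by rewrite mulr0; exact: span0.
rewrite mulrDr -scalerAr; apply: word_spanD IH; apply: word_spanZ => {k v'}.
case: bw => [y Yy y0|x' w' Xx' x0 sw|y w' Yy y0 sw].
- rewrite centered_split; apply: word_spanD; last first.
    by apply/word_spanZ/(word_span1 (b := false)); exact: word_last.
  apply: (word_span1 (b := true)); apply: word_left => //.
  + by apply: (subalgB hX) => //; exact: (subalg_scalar hX).
  + exact: state_centered.
  + exact: word_last.
- rewrite mulrA centered_split; apply: word_spanD; last first.
    by apply/word_spanZ/(word_span1 sw).
  apply: (word_span1 (b := true)); apply: word_left => //.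
  + by apply: (subalgB hX); [exact: (subalg_mul hX)|exact: (subalg_scalar hX)].
  + exact: state_centered.
- rewrite (centered_split x); apply: word_spanD; last first.
    by apply/word_spanZ/(word_span1 (b := false)); exact: word_right.
  apply: (word_span1 (b := true)); apply: word_left => //.
  + by apply: (subalgB hX) => //; exact: (subalg_scalar hX).
  + exact: state_centered.
  + exact: word_right.
Qed.

(** A constant term can arise only when a single [Y]-letter is multiplied; the subtraction removes
    it. In the other cases the product already lies in the span and has state zero. *)
Lemma word_span_mulY y v : algY y -> word_span v ->
  word_span (y * v - (phi (y * v))%:A).
Proof.
move=> Yy; elim=> [|k b w v' bw _ IH].
  by rewrite mulr0 [phi 0]linear0 scale0r subr0; exact: span0.
rewrite mulrDr -scalerAr stateD stateZ scalerDl opprD addrACA -scalerA -scalerBr.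
apply: word_spanD IH; apply: word_spanZ => {k v'}.
case: bw => [y' Yy' y0|x w' Xx x0 sw|y' w' Yy' y0 sw].
- apply: (word_span1 (b := false)); apply: word_last; last exact: state_centered.
  by apply: (subalgB hY); [exact: (subalg_mul hY)|exact: (subalg_scalar hY)].
- have s1 : word_span (y * (x * w')).
    rewrite (centered_split y); apply: word_spanD.
      apply: (word_span1 (b := false)); apply: word_right.
      + by apply: (subalgB hY) => //; exact: (subalg_scalar hY).
      + exact: state_centered.
      + exact: word_left.
    by apply/word_spanZ/(word_span1 (b := true)); exact: word_left.
  by rewrite (word_span_state s1) scale0r subr0.
- have s1 : word_span (y * (y' * w')).
    rewrite mulrA centered_split; apply: word_spanD.
      apply: (word_span1 (b := false)); apply: word_right => //.
      + by apply: (subalgB hY); [exact: (subalg_mul hY)|exact: (subalg_scalar hY)].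
      + exact: state_centered.
    by apply/word_spanZ/(word_span1 sw).
  by rewrite (word_span_state s1) scale0r subr0.
Qed.

End Freeness.
End State.

(** * Centred towers and their generating function *)

Section Subordination.
Variables (R : realType) (H : completeNormedModType R[i]).
Variable dot : {dot H for Num.conj}.
Variables (A : unitAlgType R[i]) (star : A -> A) (rep : A -> {linear H -> H}).
Variable phi : {scalar A}.
Hypothesis hA : von_neumann_algebra dot star rep.
Hypothesis hphi : faithful_normal_tracial_state dot rep phi.
Variables X Y : A.
Hypothesis free : freely_independent star phi X Y.
Implicit Types (a b c W : A) (z : R[i]).
Local Notation opnorm := (opnorm rep).
Local Notation algX := (star_generated star X).
Local Notation clX := (norm_closure rep algX).
Let hX : star_subalgebra star algX := star_generated_subalgebra star X.
Let hclX : star_subalgebra star clX := norm_closure_subalgebra hA hX.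

Definition centered a := a - (phi a)%:A.

Lemma opnorm_centered a : opnorm (centered a) <= 2 * opnorm a.
Proof.
rewrite (le_trans (opnormD hA _ _)) // (opnormN hA) mulr_natl mulr2n lerD2l.
rewrite (le_trans (opnormZ hA _ _)) // (le_trans _ (state_bounded hA hphi a)) //.
by rewrite ler_piMr ?rnorm_ge0 // (opnorm1 hA).
Qed.

Lemma centeredB a b : centered (a - b) = centered a - centered b.
Proof. by rewrite /centered stateB scalerBl !opprD addrACA. Qed.

Lemma state_mul_centered b a : phi (b * centered a) = phi (b * a) - phi b * phi a.
Proof.
by rewrite /centered mulrBr mulr_algr stateB stateZ [phi a * _]mulrC.
Qed.

(** Unlike in [nested_centering], only the tails starting with [Y] are centred; those starting with
    [W] turn out to be centred already. *)
Fixpoint centered_tower W n : A :=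
  if n is n'.+1 then Y * (W * centered (centered_tower W n')) else Y.

(** This carries statements from [W] in [algX], where freeness applies, to the norm closure. The
    restriction to distance at most [1] gives a bound on [opnorm W'], hence a constant independent
    of [W']. *)
Lemma centered_tower_lipschitz W n : exists2 k : R, 0 <= k &
  forall W', opnorm (W - W') <= 1 ->
    opnorm (centered_tower W n - centered_tower W' n) <= k * opnorm (W - W').
Proof.
elim: n => [|n [k k0 IH]].
  by exists 0 => // W' _; rewrite subrr (opnorm0 hA) mul0r.
set t := centered_tower W n in IH.
have nY := opnorm_ge0 hA Y; have nt := opnorm_ge0 hA t; have nW := opnorm_ge0 hA W.
exists (opnorm Y * (2 * opnorm t + (opnorm W + 1) * (2 * k))) => [|W' W1].
  by rewrite mulr_ge0 // addr_ge0 ?mulr_ge0 ?addr_ge0.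
have {}IH := IH _ W1; rewrite /= -/t; set t' := centered_tower W' n in IH *.
rewrite -mulrBr -mulrA (le_trans (opnormM hA _ _)) // ler_wpM2l //.
rewrite (_ : _ - _ = (W - W') * centered t + W' * centered (t - t')); last first.
  by rewrite centeredB mulrBl [W' * (centered t - _)]mulrBr subrKA.
rewrite [leRHS]mulrDl (le_trans (opnormD hA _ _)) // lerD //.
  rewrite (le_trans (opnormM hA _ _)) // mulrC ler_wpM2r ?(opnorm_ge0 hA) //.
  exact: opnorm_centered.
have W'1 : opnorm W' <= opnorm W + 1.
  have := opnormD hA (W' - W) W; rewrite subrK (opnorm_distC hA).
  by move: W1; lra.
rewrite (le_trans (opnormM hA _ _)) // -mulrA ler_pM ?(opnorm_ge0 hA) //.
by rewrite (le_trans (opnorm_centered _)) // -mulrA ler_wpM2l.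
Qed.

Lemma centered_tower_span W n : algX W ->
  word_span star phi X Y (centered (centered_tower W n)).
Proof.
move=> XW; elim: n => [|n IH].
  apply: (word_span1 (b := false)); apply: word_last.
    apply: (subalgB (star_generated_subalgebra star Y)); first by [].
    exact: (subalg_scalar (star_generated_subalgebra star Y)).
  exact: (state_centered hphi).
apply: (word_span_mulY hphi free) => //; exact: (word_span_mulX hphi).
Qed.

(** For [b] and [W] in [algX] the product lies in the span of centred words, which [phi] kills. The
    general case approximates first [b], then [W]. *)
Lemma state_mul_tower W b n : clX W -> clX b ->
  phi (b * centered (centered_tower W n)) = 0.
Proof.
move=> clW; apply: (norm_closure_state hA hphi) => {}b Xb.
set t := centered_tower W n.
have [k k0 kt] := centered_tower_lipschitz W n.
apply/rnorm_eq0/eqP; rewrite eq_le rnorm_ge0 andbT.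
apply/ler_addgt0Pr => e e0; rewrite add0r.
have nb := opnorm_ge0 hA b.
(* [m] is one more than the Lipschitz constant of the whole expression in [W]; the minimum with [1]
   below stays in the range of the Lipschitz bound. *)
set m := 1 + opnorm b * (2 * k).
have m0 : 0 < m by rewrite ltr_pwDl // !mulr_ge0.
have em0 : 0 < Num.min 1 (e / m) by rewrite lt_min ltr01 divr_gt0.
have [W' XW'] := clW _ em0.
rewrite lt_min => /andP[W1 We]; have {}kt := kt _ (ltW W1).
rewrite -/t in kt; set t' := centered_tower W' n in kt.
have t'0 : phi (b * centered t') = 0.
  by apply/(word_span_state free)/(word_span_mulX hphi) => //; exact: centered_tower_span.
rewrite -[phi _]subr0 -t'0 -stateB -mulrBr -centeredB.
rewrite (le_trans (state_bounded hA hphi _)) // (le_trans (opnormM hA _ _)) //.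
apply: (@le_trans _ _ (opnorm b * (2 * (k * opnorm (W - W'))))).
  by rewrite ler_wpM2l // (le_trans (opnorm_centered _)) // ler_wpM2l.
rewrite mulrA in We *; rewrite mulrA; rewrite ltr_pdivlMr // in We.
apply: le_trans (ltW We); rewrite mulrC ler_wpM2l ?(opnorm_ge0 hA) //.
by rewrite /m mulrA lerDr.
Qed.

Lemma state_tower W b n : clX W -> clX b ->
  phi (b * centered_tower W n) = phi b * phi (centered_tower W n).
Proof.
move=> clW clb; apply/subr0_eq; rewrite -state_mul_centered.
exact: state_mul_tower.
Qed.

(** The additional centring of [W * centered _] in the nested form subtracts zero, by
    [state_mul_tower] with [b = W]. *)
Lemma boolean_cumulant_alternating W n : clX W ->
  boolean_cumulant phi (alternating_args Y W n) = phi (centered_tower W n).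
Proof.
move=> clW; rewrite (boolean_cumulantE (state_one hphi)) //; congr (phi _).
elim: n => // n IH.
have -> : alternating_args Y W n.+1 = [:: Y, W & alternating_args Y W n] by [].
rewrite (@nested_centering_cons _ _ _ Y) // (@nested_centering_cons _ _ _ W) // IH.
rewrite -[LHS]/(Y * centered (W * centered (centered_tower W n))).
by rewrite [X in Y * X]/centered state_mul_tower // scale0r subr0.
Qed.

(** Each level contributes the norms of [Y] and [W], and a factor [2] for the centring. *)
Lemma opnorm_tower W n :
  opnorm (centered_tower W n) <= opnorm Y * (2 * (opnorm Y * opnorm W)) ^+ n.
Proof.
have nY := opnorm_ge0 hA Y; have nW := opnorm_ge0 hA W.
elim: n => [|n IH] /=; first by rewrite mulr1.
rewrite (le_trans (opnormM hA _ _)) // ler_wpM2l //.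
rewrite (le_trans (opnormM hA _ _)) //.
apply: (@le_trans _ _ (opnorm W * (2 * (opnorm Y * (2 * (opnorm Y * opnorm W)) ^+ n)))).
  by rewrite ler_wpM2l // (le_trans (opnorm_centered _)) // ler_wpM2l.
by rewrite exprS le_eqVlt; apply/orP; left; apply/eqP; ring.
Qed.

(* The partial sums of the generating function of the tower solve, up to a
   vanishing error, the equation [(1 - z Y W) T = Y (1 - z eta W)]. *)
Lemma tower_partial_sums W z n :
  let t j := centered_tower W j in
  (1 - z *: (Y * W)) * (\sum_(0 <= j < n) z ^+ j *: t j) =
  Y - (z * \sum_(0 <= j < n) phi (t j) * z ^+ j) *: (Y * W) - z ^+ n *: t n.
Proof.
move=> t; elim: n => [|n IH].
  by rewrite !big_nil !mulr0 scale0r subr0 expr0 scale1r subrr.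
rewrite !big_nat_recr //= mulrDr IH.
set e := \sum_(0 <= j < n) _; set P := Y * W.
have -> : t n.+1 = P * t n - phi (t n) *: P.
  by rewrite /t /= -/(t n) mulrA mulrBr mulr_algr.
have -> : (1 - z *: P) * (z ^+ n *: t n) = z ^+ n *: t n - z ^+ n.+1 *: (P * t n).
  by rewrite mulrBl mul1r -scalerAl -scalerAr scalerA -exprS.
have -> : (z * (e + phi (t n) * z ^+ n)) *: P =
    (z * e) *: P + (z ^+ n.+1 * phi (t n)) *: P.
  by rewrite -scalerDl; congr (_ *: _); rewrite exprS; ring.
rewrite scalerBr scalerA [in LHS]addrA subrK opprD opprB !addrA.
by rewrite subrK.
Qed.

(** The constant [4] makes the ratio [q] of the dominating geometric series at most $1/2$, which
    yields both the sum [eta] and the two inverses. *)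
Lemma subordination_series W z : clX W ->
  4 * (rnorm z * (opnorm Y * opnorm W)) <= 1 ->
  exists eta : R[i],
  [/\ series (fun n => boolean_cumulant phi (alternating_args Y W n) * z ^+ n : R[i]^o)
        @ \oo --> (eta : R[i]^o),
      1 - z *: (Y * W) \is a GRing.unit,
      1 - (z * eta) *: W \is a GRing.unit,
      clX (1 - (z * eta) *: W)^-1 &
      forall b, clX b -> phi (b * ((1 - z *: (Y * W))^-1 * Y)) =
        phi ((1 - (z * eta) *: W)^-1 * b) * eta].
Proof.
move=> clW zYW; have nY := opnorm_ge0 hA Y; have nW := opnorm_ge0 hA W.
have nz := rnorm_ge0 z.
pose q := 2 * (rnorm z * (opnorm Y * opnorm W)).
have q0 : 0 <= q by rewrite !mulr_ge0.
have q12 : q <= 2^-1 by rewrite /q; lra.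
have q1 : q < 1 by apply: le_lt_trans q12 _; rewrite invf_lt1 ?ltr1n.
set u : nat -> R[i]^o := fun n => _.
have uE n : u n = phi (centered_tower W n) * z ^+ n.
  by rewrite /u boolean_cumulant_alternating.
have tn n : rnorm z ^+ n * opnorm (centered_tower W n) <= opnorm Y * q ^+ n.
  apply: (le_trans (ler_wpM2l (exprn_ge0 _ nz) (opnorm_tower W n))).
  rewrite /q !exprMn le_eqVlt; apply/orP; left; apply/eqP; ring.
have un n : rnorm (u n) <= opnorm Y * q ^+ n.
  rewrite uE rnormM rnormX mulrC; apply: le_trans (tn n).
  by rewrite ler_wpM2l ?exprn_ge0 // (state_bounded hA hphi).
have q01 : 0 <= q < 1 by rewrite q0.
have cu := geometric_series_cvg q01 un.
pose eta := limn (series u); exists eta.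
have seta : rnorm (series u n - eta) @[n --> \oo] --> (0 : R).
  by apply/rnorm_cvgP.
(* As $q \le 1/2$, the dominating series sums to at most $2\|Y\|$; hence $\|z\eta W\| \le q < 1$. *)
have eta_le : rnorm eta <= 2 * opnorm Y.
  apply/ler_addgt0Pr => e e0.
  move/cvgrPdist_lt: seta => /(_ _ e0) [n _ /(_ n (leqnn n)) /=].
  rewrite sub0r normrN ger0_norm ?rnorm_ge0 // => ne.
  rewrite -(subrK (series u n) eta) addrC (le_trans (rnormD _ _)) //.
  rewrite lerD //; last by rewrite rnorm_distC ltW.
  have inc m : rnorm (series u m.+1 - series u m) <= opnorm Y * q ^+ m.
    by rewrite seriesSB.
  have := geometric_increments_le nY q01 inc 0 n.
  rewrite add0n expr0 mulr1 {2}/series /= big_geq // subr0 => /le_trans; apply.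
  rewrite mulrC ler_wpM2r // -[leRHS]invrK lef_pV2 ?posrE ?invr_gt0 ?subr_gt0 //.
  by move: q12; lra.
have zYW1 : opnorm (z *: (Y * W)) < 1.
  rewrite (le_lt_trans (opnormZ hA _ _)) //.
  rewrite (le_lt_trans (ler_wpM2l nz (opnormM hA _ _))) //.
  by move: q12 q1; rewrite /q; lra.
have uV := neumann_unit hA zYW1.
set V := (1 - z *: (Y * W))^-1.
have zeW1 : opnorm ((z * eta) *: W) < 1.
  rewrite (le_lt_trans (opnormZ hA _ _)) // rnormM.
  apply: (@le_lt_trans _ _ (rnorm z * (2 * opnorm Y) * opnorm W)).
    by rewrite ler_wpM2r // ler_wpM2l.
  by move: q12 q1; rewrite /q; lra.
have uK := neumann_unit hA zeW1.
set K := (1 - (z * eta) *: W)^-1.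
have clK : clX K.
  apply: (neumann_mem hA hclX) => //; first exact: (norm_closure_closed hA).
  exact: (subalgZ hclX).
split=> //.
have key b : clX b -> phi (b * (V * Y)) - z * eta * phi (b * (V * (Y * W))) = phi b * eta.
  move=> clb; apply/subr0_eq; set c0 := _ - _.
  (* The left side is free of [n], while the right side tends to zero: its first term by convergence
     of the series, its second by the geometric bound on the tower. *)
  have c0E n : c0 = (series u n - eta) * (z * phi (b * (V * (Y * W))) + phi b) +
      z ^+ n * phi (b * (V * centered_tower W n)).
    have := congr1 (fun a => phi (b * (V * a))) (tower_partial_sums W z n).
    rewrite /= [V * (_ * _)]mulrA mulVr // mul1r.
    have -> : \sum_(0 <= j < n) phi (centered_tower W j) * z ^+ j = series u n.
      by apply: eq_bigr => j _; rewrite uE.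
    have -> : phi (b * (\sum_(0 <= j < n) z ^+ j *: centered_tower W j)) = phi b * series u n.
      rewrite mulr_sumr [LHS]linear_sum /series /= mulr_sumr; apply: eq_bigr => j _.
      by rewrite -scalerAr stateZ state_tower // uE; ring.
    rewrite !mulrBr -!scalerAr !stateB !stateZ => E.
    move/eqP: E; rewrite -subr_eq0 => /eqP E.
    rewrite /c0 -[RHS]subr0 -E; ring.
  apply/rnorm_eq0/eqP; rewrite eq_le rnorm_ge0 andbT.
  pose k1 := rnorm (z * phi (b * (V * (Y * W))) + phi b).
  pose k2 := opnorm b * opnorm V * opnorm Y.
  have : k1 * rnorm (series u n - eta) + k2 * q ^+ n @[n --> \oo] --> k1 * 0 + k2 * (0 : R).
    apply: cvgD; apply: cvgMr => //; apply: cvg_expr; rewrite ger0_norm //.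
  rewrite !mulr0 addr0 => lim0.
  apply: (cvgr_to_ge lim0); apply: nearW => n.
  rewrite (c0E n) (le_trans (rnormD _ _)) // (rnormM _ (_ + phi b)).
  rewrite [rnorm (_ - _) * _]mulrC lerD2l rnormM rnormX.
  rewrite (le_trans (ler_wpM2l _ (state_bounded hA hphi _))) ?exprn_ge0 //.
  apply: (@le_trans _ _ (rnorm z ^+ n * (opnorm b * (opnorm V * opnorm (centered_tower W n))))).
    rewrite ler_wpM2l ?exprn_ge0 // (le_trans (opnormM hA _ _)) //.
    by rewrite ler_wpM2l ?(opnorm_ge0 hA) // (opnormM hA).
  rewrite /k2 -!mulrA mulrCA ler_wpM2l ?(opnorm_ge0 hA) //.
  by rewrite mulrCA ler_wpM2l ?(opnorm_ge0 hA).
(* [key] is used with [K * b] for [b]; under the trace [K] then cancels against its inverse. *)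
move=> b clb; rewrite -key; last exact: (subalg_mul hclX).
rewrite -stateZ -stateB.
have -> : K * b * (V * Y) - (z * eta) *: (K * b * (V * (Y * W))) =
    K * (b * (V * Y) * (1 - (z * eta) *: W)).
  by rewrite mulrBr mulr1 -scalerAr mulrBr -scalerAr !mulrA.
by rewrite (state_trace hphi K) mulrK.
Qed.

(** By continuity [b = star d] is also admissible, and faithfulness applies. *)
Lemma norm_closure_separated d : clX d ->
  (forall b, algX b -> phi (b * d) = 0) -> d = 0.
Proof.
move=> cld d0; apply: (state_star_mul_eq0 hA hphi).
apply: (norm_closure_state hA hphi d0).
exact: (subalg_star hclX).
Qed.

(** This reduces the operator equations defining [omega1] and [F] to scalar identities tested
    against [algX]. *)
Lemma state_conditional_expectation (E : {linear A -> A}) a b :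
  conditional_expectation dot rep phi (vn_generated star rep X) E -> algX b ->
  phi (b * E a) = phi (b * a).
Proof.
move=> hE Xb; have vn c : algX c -> vn_generated star rep X c.
  by move=> Xc B [hB _] BX; exact: Xc.
have := ce_bimodule hE a (vn _ Xb) (vn _ (subalg_one hX)).
by rewrite !mulr1 => <-; rewrite (ce_preserves hE).
Qed.

(** * Additive subordination near infinity *)

Lemma additive_resolvent_state z eta b : let W := (z%:A - X)^-1 in
  let K := (1 - eta *: W)^-1 in
  z%:A - X \is a GRing.unit -> 1 - Y * W \is a GRing.unit ->
  1 - eta *: W \is a GRing.unit ->
  phi (W * b * W * ((1 - Y * W)^-1 * Y)) = phi (K * (W * b * W)) * eta ->
  phi (b * (z%:A - X - Y)^-1) = phi (b * ((z - eta)%:A - X)^-1).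
Proof.
move=> W K uD uV uK key; set D := z%:A - X in W K uD uV uK key *.
have -> : D - Y = (1 - Y * W) * D by rewrite mulrBl mul1r mulrVK.
have -> : (z - eta)%:A - X = D * (1 - eta *: W).
  by rewrite mulrBr mulr1 -scalerAr divrr // scalerBl addrAC.
rewrite !invrM // -/W -/K; set V := (1 - Y * W)^-1 in key *.
(* Both inverses are expanded by one geometric step; the terms $bW$ agree, and cyclic rotation turns
   the remainders into the two sides of [key]. *)
have VE : V = 1 + V * Y * W.
  by apply/eqP; rewrite -subr_eq -{1}[V]mulr1 -mulrA -mulrBr mulVr.
have KE : K = 1 + eta *: (W * K).
  by apply/eqP; rewrite -subr_eq -{1}[K]mul1r scalerAl -mulrBl divrr.
have -> : b * (W * V) = b * W + b * W * (V * Y) * W.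
  by rewrite {1}VE mulrDr mulr1 mulrDr !mulrA.
have -> : b * (K * W) = b * W + eta *: (b * W * K * W).
  by rewrite {1}KE mulrDl mul1r mulrDr -scalerAl -scalerAr !mulrA.
rewrite !stateD stateZ; congr (_ + _).
rewrite (state_trace hphi _ W) (state_trace hphi (b * W * K) W) !mulrA.
rewrite (state_trace hphi _ K) mulrC.
by rewrite !mulrA in key *.
Qed.

Lemma additive_subordination_series (E : {linear A -> A}) (omega1 : R[i] -> R[i]) :
  self_adjoint star X ->
  conditional_expectation dot rep phi (vn_generated star rep X) E ->
  additive_subordination E X Y omega1 ->
  exists r : R, forall z : R[i], upper_half_plane z -> r%:C < `|z| ->
    let u : nat -> R[i]^o :=
      fun n => boolean_cumulant phi (alternating_args Y (z%:A - X)^-1 n) in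
    cvgn (series u) /\ omega1 z = z - limn (series u).
Proof.
(* Beyond this radius $|z| > \|X\|$, so the resolvent [W] exists, and $|z| - \|X\|$ exceeds $4\|Y\|
   + 1$, so $4\|Y\|\,\|W\| \le 1$. *)
move=> sX hE [ana hom]; exists (opnorm X + (4 * opnorm Y + 1)) => z z0 rz u.
have nX := opnorm_ge0 hA X; have nY := opnorm_ge0 hA Y.
rewrite rnormE ltcR in rz.
have clXX : clX X by apply: (sub_norm_closure hA).
have clcl : norm_closed rep clX by exact: (norm_closure_closed hA).
have zX : opnorm X < rnorm z by move: rz; lra.
have [uD clW] := large_resolvent_mem hA hclX clcl clXX zX.
set W := (z%:A - X)^-1 in clW u *.
have nW : opnorm W * (4 * opnorm Y + 1) <= 1.
  have m0 : 0 < 4 * opnorm Y + 1 by rewrite ltr_wpDl // mulr_ge0.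
  rewrite -ler_pdivlMr // mul1r; apply: (opnorm_le (rep := rep)) => [|v].
    by rewrite invr_ge0 ltW.
  rewrite mulrC ler_pdivlMr // mulrC.
  have : rnorm z * rnorm (rep W v) <= rnorm v + opnorm X * rnorm (rep W v).
    have {2}-> : v = rep ((z%:A - X) * W) v by rewrite divrr // (vna_one hA).
    rewrite -rnormZ (vna_mul hA) (repB hA) (repZ hA) (vna_one hA).
    rewrite -{1}(subrK (rep X (rep W v)) (z *: _)) (le_trans (rnormD _ _)) //.
    by rewrite lerD2l (opnormP hA).
  have := rnorm_ge0 (rep W v); move: rz; nra.
have small : 4 * (rnorm (1 : R[i]) * (opnorm Y * opnorm W)) <= 1.
  have := opnorm_ge0 hA W; rewrite (rnorm_real (1 : R)) normr1.
  by move: nW nY; lra.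
have [eta [cv uV uK clK key]] := subordination_series clW small.
rewrite scale1r in uV; rewrite mul1r in uK clK key.
have uE : (fun n => boolean_cumulant phi (alternating_args Y W n) * 1 ^+ n) = u.
  by apply/funext => n; rewrite expr1n mulr1.
rewrite uE in cv; split; first by apply/cvg_ex; exists eta.
rewrite (cvg_lim (@norm_hausdorff _ _) cv).
(* Nothing is known about the modulus of [omega1 z], so membership of its resolvent in [clX] rests
   on its being nonreal. *)
have [oz _] := ana _ z0.
have [_ cl1] := resolvent_mem hA hclX clcl clXX sX (lt0r_neq0 oz).
have zeK : ((z - eta)%:A - X)^-1 = (1 - eta *: W)^-1 * W.
  rewrite -invrM //; congr _^-1.
  by rewrite mulrBr mulr1 -scalerAr divrr // scalerBl addrAC.
have : (omega1 z)%:A - X = (z - eta)%:A - X.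
  apply: invr_inj; apply/subr0_eq/norm_closure_separated.
    by apply: (subalgB hclX) => //; rewrite zeK; exact: (subalg_mul hclX).
  move=> b Xb; rewrite mulrBr stateB -(hom z z0) (state_conditional_expectation _ hE) //.
  apply/eqP; rewrite subr_eq0; apply/eqP.
  apply: additive_resolvent_state => //; rewrite -/W -key ?scale1r //.
  apply: (subalg_mul hclX) => //; apply: (subalg_mul hclX) => //.
  exact: (sub_norm_closure hA).
move/addIr/eqP; rewrite -subr_eq0 -scalerBl scaler_eq0 oner_eq0 orbF subr_eq0.
by move/eqP.
Qed.

(** * Multiplicative subordination near the origin *)

Lemma series_mulr (u : nat -> R[i]^o) z (l : R[i]^o) :
  series u @ \oo --> l ->
  series (fun n => z * u n : R[i]^o) @ \oo --> (z * l : R[i]^o).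
Proof.
move=> ul; have -> : series (fun n => z * u n : R[i]^o) = (fun n => z *: series u n).
  by apply/funext => n; rewrite /series /= scaler_sumr.
by apply: cvgZr.
Qed.

(** As [S] is self-adjoint, its commutant in [A] is a star-subalgebra, and it contains
    [X = S * S]. *)
Lemma star_generated_commute S : self_adjoint star S -> X = S * S ->
  forall b, algX b -> S * b = b * S.
Proof.
move=> sS XS b Xb; apply: (Xb [set a | S * a = a * S]); last by rewrite /= XS mulrA.
split=> [|k a c aS cS|a c aS cS|a aS] /=.
- by rewrite mulr1 mul1r.
- by rewrite mulrDr mulrDl -scalerAr -scalerAl aS cS.
- by rewrite mulrA aS -mulrA cS mulrA.
- by rewrite -{1}sS -(starM hA) -aS (starM hA) sS.
Qed.

(** The push-through identity $YS(1-zSYS)^{-1} = (1-zYX)^{-1}YS$ moves the square root outside;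
    traciality and commutation with [b] then merge the two copies of [S] into [X]. *)
Lemma multiplicative_resolvent_state S z eta b :
  let V := (1 - z *: (Y * X))^-1 in let K := (1 - (z * eta) *: X)^-1 in
  X = S * S -> S * b = b * S ->
  1 - z *: (S * Y * S) \is a GRing.unit -> 1 - z *: (Y * X) \is a GRing.unit ->
  phi (b * X * (V * Y)) = phi (K * (b * X)) * eta ->
  phi (b * ((z *: (S * Y * S)) * (1 - z *: (S * Y * S))^-1)) =
  phi (b * (((z * eta) *: X) * K)).
Proof.
move=> V K XS Sb uQ uV key; set Q := 1 - z *: (S * Y * S) in uQ *.
have YSQ : Y * S * Q^-1 = V * (Y * S).
  apply: (mulIr uQ); rewrite mulrVK // -mulrA; apply: (mulrI uV).
  rewrite mulrA [RHS]mulrA mulrV // mul1r /Q mulrBl mulrBr mul1r mulr1.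
  by rewrite -scalerAl -scalerAr XS !mulrA.
rewrite -!scalerAl -!scalerAr !stateZ -[z * eta * _]mulrA; congr (_ * _).
have -> : b * (S * Y * S * Q^-1) = b * S * (V * Y) * S.
  have -> : S * Y * S * Q^-1 = S * (Y * S * Q^-1) by rewrite !mulrA.
  by rewrite YSQ !mulrA.
rewrite (state_trace hphi _ S) !mulrA Sb -[b * S * S]mulrA -XS.
by rewrite mulrA in key; rewrite key mulrC (state_trace hphi K) -mulrA.
Qed.

Lemma multiplicative_subordination_series (S : A) (E : {linear A -> A})
    (F : R[i] -> R[i]) :
  self_adjoint star X -> X != 0 -> positive_sqrt dot rep X S ->
  conditional_expectation dot rep phi (vn_generated star rep X) E ->
  multiplicative_subordination E X S Y F ->
  \forall z \near (0 : R[i]^o), upper_half_plane z ->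
    let u : nat -> R[i]^o :=
      fun n => boolean_cumulant phi (alternating_args Y X n) * z ^+ n.+1 in
    cvgn (series u) /\ F z = limn (series u).
Proof.
move=> sX X0 [posS SS] hE [ana _ hF].
have sS := positive_self_adjoint hA posS; have XS : X = S * S by [].
have nX := opnorm_ge0 hA X; have nY := opnorm_ge0 hA Y.
have nQ := opnorm_ge0 hA (S * Y * S).
(* The first summand serves [subordination_series], the second the inverse of $1 - zSYS$, and the
   last keeps [m] positive. *)
set m := 4 * (opnorm Y * opnorm X) + opnorm (S * Y * S) + 1.
have m0 : 0 < m by rewrite ltr_wpDl // addr_ge0 // !mulr_ge0.
apply/nbhs_norm0P; exists (m^-1)%:C => /=; first by rewrite ltcR invr_gt0.
move=> z /=; rewrite rnormE ltcR => zm z0.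
pose u : nat -> R[i]^o :=
  fun n => boolean_cumulant phi (alternating_args Y X n) * z ^+ n.+1.
rewrite -/u.
have {}zm : rnorm z * m < 1 by rewrite -ltr_pdivlMr // mul1r.
have nz := rnorm_ge0 z.
have clXX : clX X by apply: (sub_norm_closure hA).
have clcl : norm_closed rep clX by exact: (norm_closure_closed hA).
have small : 4 * (rnorm z * (opnorm Y * opnorm X)) <= 1.
  rewrite mulrCA (le_trans _ (ltW zm)) // ler_wpM2l // /m -addrA lerDl.
  by rewrite addr_ge0.
have uQ : 1 - z *: (S * Y * S) \is a GRing.unit.
  apply: (neumann_unit hA); rewrite (le_lt_trans (opnormZ hA _ _)) //.
  apply: le_lt_trans zm; rewrite ler_wpM2l // /m [_ + opnorm _]addrC -addrA lerDl.
  by rewrite addr_ge0 // !mulr_ge0.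
have [eta [cv uV uK clK key]] := subordination_series clXX small.
have cvu : series u @ \oo --> (z * eta : R[i]^o).
  have -> : u = (fun n => z * (boolean_cumulant phi (alternating_args Y X n) * z ^+ n)).
    by apply/funext => n; rewrite /u exprS mulrCA.
  exact: series_mulr.
split; first by apply/cvg_ex; exists (z * eta).
rewrite (cvg_lim (@norm_hausdorff _ _) cvu).
have [Fz _] := ana _ z0.
have F0 : F z != 0 by apply: contraTneq Fz => ->; rewrite /upper_half_plane /= ltxx.
(* The inverse of $1 - F(z)X$ is a multiple of the resolvent of $X$ at $F(z)^{-1}$, which is
   nonreal; so it lies in [clX] whatever the size of [F z]. *)
have FVim : complex.Im (F z)^-1 != 0.
  apply: contraTneq Fz => FV0; rewrite /upper_half_plane /= -[F z]invrK.
  have -> : (F z)^-1 = (complex.Re (F z)^-1)%:C.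
    by move: FV0; case: ((F z)^-1) => x y /= ->.
  by rewrite -fmorphV ltxx.
have [uF clF] := resolvent_mem hA hclX clcl clXX sX FVim.
have FE : 1 - F z *: X = F z *: ((F z)^-1%:A - X).
  by rewrite scalerBr scalerA divff // scale1r.
have unitF : 1 - F z *: X \is a GRing.unit by rewrite FE scaler_unit // unitfE.
have clF1 : clX (1 - F z *: X)^-1.
  by rewrite FE invrZ ?unitfE //; exact: (subalgZ hclX).
set K := (1 - (z * eta) *: X)^-1 in clK key.
have eqE : (F z *: X) * (1 - F z *: X)^-1 = ((z * eta) *: X) * K.
  apply/subr0_eq/norm_closure_separated.
    apply: (subalgB hclX); apply: (subalg_mul hclX) => //; exact: (subalgZ hclX).
  move=> b Xb; rewrite mulrBr stateB -(hF z z0) (state_conditional_expectation _ hE) //.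
  apply/eqP; rewrite subr_eq0; apply/eqP.
  apply: multiplicative_resolvent_state => //.
    exact: (star_generated_commute sS XS).
  by apply: key; apply: (subalg_mul hclX) => //; exact: (sub_norm_closure hA).
(* Since $(1-a)^{-1} = 1 + a(1-a)^{-1}$, the equality [eqE] gives equal inverses, hence
   [F z *: X = (z * eta) *: X], and [X] is nonzero. *)
have geom a : 1 - a \is a GRing.unit -> (1 - a)^-1 = 1 + a * (1 - a)^-1.
  by move=> ua; apply/eqP; rewrite -subr_eq -{1}[_^-1]mul1r -mulrBl divrr.
have : (1 - F z *: X)^-1 = (1 - (z * eta) *: X)^-1.
  by rewrite (geom _ unitF) eqE -geom.
move/invr_inj/addrI/oppr_inj/eqP; rewrite -subr_eq0 -scalerBl scaler_eq0 (negbTE X0) orbF.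
by rewrite subr_eq0 => /eqP.
Qed.

End Subordination.

Theorem corollary1p2 (R : realType) (H : completeNormedModType R[i])
    (dot : {dot H for Num.conj}) (A : unitAlgType R[i]) (star : A -> A)
    (rep : A -> {linear H -> H}) (phi : {scalar A})
    (hA : von_neumann_algebra dot star rep)
    (hphi : faithful_normal_tracial_state dot rep phi) :
  (forall (X Y : A) (E : {linear A -> A}) (omega1 : R[i] -> R[i]),
    self_adjoint star X -> self_adjoint star Y -> freely_independent star phi X Y ->
    conditional_expectation dot rep phi (vn_generated star rep X) E ->
    additive_subordination E X Y omega1 ->
    exists r : R, forall z : R[i], upper_half_plane z -> r%:C < `|z| ->
      let u : nat -> R[i]^o :=
        fun n => boolean_cumulant phi (alternating_args Y (z%:A - X)^-1 n) in
      cvgn (series u) /\ omega1 z = z - limn (series u))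
  /\
  (forall (X S Y : A) (E : {linear A -> A}) (F : R[i] -> R[i]),
    positive dot rep X -> positive dot rep Y -> freely_independent star phi X Y ->
    (* for X = 0 the equation defining F holds for every F *)
    X != 0 ->
    positive_sqrt dot rep X S ->
    conditional_expectation dot rep phi (vn_generated star rep X) E ->
    multiplicative_subordination E X S Y F ->
    \forall z \near (0 : R[i]^o), upper_half_plane z ->
      let u : nat -> R[i]^o :=
        fun n => boolean_cumulant phi (alternating_args Y X n) * z ^+ n.+1 in
      cvgn (series u) /\ F z = limn (series u)).
Proof.
split=> [X Y E omega1 sX _ free hE hom|X S Y E F pX _ free X0 hS hE hF].
  exact: (additive_subordination_series hA hphi free sX hE hom).
have sX := positive_self_adjoint hA pX.
exact: (multiplicative_subordination_series hA hphi free sX X0 hS hE hF).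
Qed.
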